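(* Let $u_0:\mathbb{R}^d\to\mathbb{R}$, $d\ge3$, be a function whose Fourier transform is real-valued, nonnegative on $\mathbb{R}^d\setminus\{0\}$, and bounded away from zero on some nonempty open subset of $\mathbb{R}^d$. Then there exists $a_0>0$ such that for any $a\ge a_0$, the solution $u$ of the Cauchy problem $$\partial_tu-\Delta u=\sqrt{-\Delta}\,(u^2)\ \text{ in }\mathbb{R}^d\times(0,\infty),\qquad u(\cdot,0)=au_0,$$ satisfies $u(\cdot,1)\notin\dot B^\alpha_{-\infty,\infty}$ for any $\alpha\in\mathbb{R}$.
   Context: Fourier transform: $\mathscr{F}\{u\}(\xi)=c_0\int_{\mathbb{R}^d}u(x)e^{-ix\cdot\xi}dx$, $c_0=(2\pi)^{-d/2}$. The solution: the Cauchy problem is understood through the Fourier-transformed integral equation for $v=\mathscr{F}\{u\}$, $v_0=\mathscr{F}\{au_0\}$, $$v(\xi,t)=e^{-t|\xi|^2}v_0(\xi)+c_0\int_0^te^{-s|\xi|^2}|\xi|\int_{\mathbb{R}^d}v(\eta,t-s)v(\xi-\eta,t-s)\,d\eta\,ds ,$$ and the solution $u$ is the one with $\mathscr{F}\{u\}=v\in[0,\infty]$ equal to the pointwise limit of the nondecreasing Picard iteration $v^{(0)}=0$, $v^{(n+1)}=$ right-hand side evaluated at $v^{(n)}$. (Equivalently $v=h\psi/c_0$ with $h(\xi)=c_d|\xi|^{1-d}$ the scale-invariant kernel, $h*h=|\xi|h$, and $\psi$ the minimal cascade solution $\psi(\xi,t)=\mathbb{E}_\xi\big[\mathbbm{1}_{\zeta>t}\prod\psi_0(W_v)\big]$,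 $\psi_0=c_0v_0/h$, the product being over the vertices of the associated branching cascade alive at time $t$.) If $v(\cdot,1)$ is infinite on a set of positive measure, then $u(\cdot,1)$ is regarded as not belonging to any of the spaces below. Besov space: let $\phi:\mathbb{R}^d\to\mathbb{R}$ be a Schwartz function whose Fourier transform takes values in $[0,1]$, is supported in $\{1/4\le|\xi|\le1\}$, and satisfies $\sum_{j\in\mathbb{Z}}\mathscr{F}\{\phi\}(2^j\xi)=1$ for all $\xi\ne0$. Put $\phi_j(x)=2^{dj}\phi(2^jx)$. Then $$\dot B^\alpha_{-\infty,\infty}(\mathbb{R}^d)=\Big\{f\in L^1_{\rm loc}(\mathbb{R}^d):\ \|f\|_{\dot B^\alpha_{-\infty,\infty}}=\sup_{j\in\mathbb{Z}}2^{\alpha j}\|\phi_j*f\|_{L^\infty}<\infty\Big\}.$$ *)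

(* Defs.v *)
From HB Require Import structures.
From mathcomp Require Import all_boot all_order all_algebra.
From mathcomp Require Import all_classical all_reals all_analysis.
From mathcomp Require Import complex.

Set Implicit Arguments.
Unset Strict Implicit.
Unset Printing Implicit Defensive.

Import Order.TTheory GRing.Theory Num.Theory.
Import numFieldNormedType.Exports.

Local Open Scope classical_set_scope.
Local Open Scope ring_scope.

Definition rV_display : measure_display.
Proof. exact: default_measure_display. Qed.

Section borel_rV.
Variables (R : realType) (n : nat).

Let coord (i : 'I_n) (x : 'rV[R]_n) : measurableTypeR R := x 0 i.

Let rV_set0 : g_sigma_preimage coord set0.
Proof. exact: sigma_algebra0. Qed.

Let rV_setC A : g_sigma_preimage coord A -> g_sigma_preimage coord (~` A).
Proof. exact: sigma_algebraC. Qed.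

Let rV_bigcup (F : (set 'rV[R]_n)^nat) :
  (forall i, g_sigma_preimage coord (F i)) ->
  g_sigma_preimage coord (\bigcup_i (F i)).
Proof. exact: sigma_algebra_bigcup. Qed.

(* generated by the coordinate functions, hence the Borel sigma-algebra *)
HB.instance Definition _ :=
  @isMeasurable.Build rV_display 'rV[R]_n
    (g_sigma_preimage coord) rV_set0 rV_setC rV_bigcup.

Lemma measurable_coord (i : 'I_n) :
  measurable_fun [set: 'rV[R]_n] (fun x : 'rV[R]_n => x 0 i : measurableTypeR R).
Proof.
move=> _ Y mY; rewrite setTI; apply: sub_sigma_algebra => /=.
rewrite -bigcup_seq/=; exists i => /=; first by rewrite mem_index_enum.
by exists Y => //; rewrite setTI.
Qed.

Lemma measurable_fun_rVP d (T : measurableType d) (f : T -> 'rV[R]_n) :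
  (forall i, measurable_fun [set: T] (fun x => f x 0 i : measurableTypeR R)) ->
  measurable_fun [set: T] f.
Proof.
move=> mf.
have sub : g_sigma_preimage (fun i => coord i \o f) `<=` measurable.
  apply: smallest_sub; first exact: sigma_algebra_measurable.
  rewrite -bigcup_seq => A [i _ [B mB <-]]; exact: mf.
rewrite g_sigma_preimage_comp in sub.
by move=> _ A mA; apply: sub; exists A.
Qed.

End borel_rV.

Section lebesgue_rV.
Variable R : realType.

Definition consrV n (p : measurableTypeR R * 'rV[R]_n) : 'rV[R]_n.+1 :=
  \row_i oapp (fun j => p.2 0 j) p.1 (unlift ord0 i).

Definition splitrV n (x : 'rV[R]_n.+1) : measurableTypeR R * 'rV[R]_n :=
  (x 0 ord0, \row_j x 0 (lift ord0 j)).

Lemma consrVK n : cancel (@consrV n) (@splitrV n).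
Proof.
move=> [a v]; rewrite /splitrV mxE unlift_none/=; congr pair.
by apply/rowP => j; rewrite !mxE liftK.
Qed.

Lemma measurable_consrV n : measurable_fun setT (@consrV n).
Proof.
apply: measurable_fun_rVP => i; under eq_fun do rewrite mxE.
case: unliftP => [j _|_] /=; last exact: measurable_fst.
exact: (measurableT_comp (measurable_coord j) measurable_snd).
Qed.

Lemma measurable_splitrV n : measurable_fun setT (@splitrV n).
Proof.
apply/measurable_fun_pairP; split; first exact: measurable_coord.
apply: measurable_fun_rVP => i; under eq_fun do rewrite /= mxE.
exact: measurable_coord.
Qed.

Section step.
Variables (n : nat) (mu : {sigma_finite_measure set 'rV[R]_n -> \bar R}).

Definition lebesgue_step : set 'rV[R]_n.+1 -> \bar R :=
  pushforward (@lebesgue_measure R \x mu)%E (@consrV n).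


Let step : {measure set 'rV[R]_n.+1 -> \bar R} :=
  measure_function_pushforward__canonical__measure_function_Measure
    (@lebesgue_measure R \x mu)%E (@measurable_consrV n).

HB.instance Definition _ := isMeasure.Build _ _ _ lebesgue_step
  (measure0 step) (measure_ge0 step) (@measure_semi_sigma_additive _ _ _ step).

Let lebesgue_step_sigma_finite : sigma_finite setT lebesgue_step.
Proof.
have /sigma_finiteP[F [TF ndF Foo]] := sigma_finiteT (@lebesgue_measure R).
have /sigma_finiteP[G [TG ndG Goo]] := sigma_finiteT mu.
exists (fun k => @splitrV n @^-1` (F k `*` G k)).
  rewrite -preimage_bigcup -[LHS](preimage_setT (@splitrV n)) -setXTT TF TG.
  congr (_ @^-1` _); apply/seteqP; split => -[x y]; last first.
    by move=> [k _ []/= ? ?]; split; exists k.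
  move=> [/= [k _ Fkx] [l _ Gly]]; exists (maxn k l) => //; split.
  - by move: x Fkx; exact/subsetPset/ndF/leq_maxl.
  - by move: y Gly; exact/subsetPset/ndG/leq_maxr.
move=> k; have [mF Fk] := Foo k; have [mG Gk] := Goo k; split.
  rewrite -[X in measurable X]setTI; apply: measurable_splitrV => //.
  exact: measurableX.
rewrite /lebesgue_step /pushforward -comp_preimage.
rewrite (_ : _ \o _ = id) ?preimage_id; last exact/funext/consrVK.
by rewrite product_measure1E// lte_mul_pinfty// ge0_fin_numE.
Qed.

HB.instance Definition _ := Measure_isSigmaFinite.Build _ _ _ lebesgue_step
  lebesgue_step_sigma_finite.

End step.

Fixpoint lebesgue_rV n : {sigma_finite_measure set 'rV[R]_n -> \bar R} :=
  if n is m.+1 then lebesgue_step (lebesgue_rV m) else \d_(0 : 'rV[R]_0).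

Lemma lebesgue_rV_box n (a b : 'rV[R]_n) : (forall i, a 0 i <= b 0 i) ->
  lebesgue_rV n [set x : 'rV[R]_n | forall i, x 0 i \in `[a 0 i, b 0 i]] =
  (\prod_(i < n) (b 0 i - a 0 i))%:E.
Proof.
elim: n a b => [|n IHn] a b ab.
  rewrite big_ord0 /= diracE mem_set//= => -[].
  by move=> m m0; have := m0.
set B := [set x : 'rV[R]_n.+1 | _].
have -> : lebesgue_rV n.+1 B = (@lebesgue_measure R \x lebesgue_rV n)%E
   (`[a 0 ord0, b 0 ord0]%classic `*`
    [set x : 'rV[R]_n | forall i, x 0 i \in `[a 0 (lift ord0 i), b 0 (lift ord0 i)]]).
  congr (product_measure1 _ _ _); apply/seteqP; split => -[x v]/=.
    move=> xv; split.
      by have := xv ord0; rewrite mxE unlift_none.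
    by move=> i; have := xv (lift ord0 i); rewrite mxE liftK.
  move=> [x0 vi] i; rewrite mxE; case: unliftP => [j ->|->] //=; exact: vi.
have mB : measurable [set x : 'rV[R]_n | forall i,
    x 0 i \in `[a 0 (lift ord0 i), b 0 (lift ord0 i)]].
  rewrite (_ : mkset _ = \big[setI/setT]_(i < n) ((fun x : 'rV[R]_n => x 0 i) @^-1`
     `[a 0 (lift ord0 i), b 0 (lift ord0 i)]%classic)).
    apply: bigsetI_measurable => i _; rewrite -[X in measurable X]setTI.
    by apply: (measurable_coord i measurableT); exact: measurable_itv.
  apply/seteqP; split => x /=.
    by move=> xi; rewrite -bigcap_seq => i _ /=; exact: xi.
  by rewrite -bigcap_seq => xi i; apply: (xi i); rewrite /= mem_index_enum.
rewrite product_measure1E//.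
rewrite (_ : mkset _ = [set x : 'rV[R]_n | forall i,
    x 0 i \in `[(\row_i a 0 (lift ord0 i)) 0 i,
                (\row_i b 0 (lift ord0 i)) 0 i]]); last first.
  by apply/seteqP; split => x /= xi i; have := xi i; rewrite !mxE.
rewrite IHn; last by move=> i; rewrite !mxE.
under eq_bigr do rewrite !mxE.
rewrite big_ord_recl EFinM; congr (_ * _)%E.
rewrite /= lebesgue_measure_itv/= lte_fin.
have := ab ord0; rewrite le_eqVlt => /orP[/eqP->|->//].
by rewrite ltxx subrr.
Qed.

End lebesgue_rV.

Section euclidean.
Variables (R : realType) (d : nat).
Implicit Types (x y xi : 'rV[R]_d) (f g theta phi : 'rV[R]_d -> R).

Definition dotrV x y : R := \sum_(i < d) x 0 i * y 0 i.

(* Euclidean norm; the library norm `|x| on 'rV[R]_d is the sup norm *)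
Definition enorm x : R := Num.sqrt (dotrV x x).

Definition partials (s : seq 'I_d) f : 'rV[R]_d -> R :=
  foldr (fun i g x => 'D_(delta_mx 0 i) g x) f s.

Definition smooth f := forall s : seq 'I_d, continuous (partials s f) /\
  forall (i : 'I_d) x, derivable (partials s f) x (delta_mx 0 i).

Definition schwartz f := smooth f /\
  forall (s : seq 'I_d) (N : nat), exists C : R,
    forall x, enorm x ^+ N * `|partials s f x| <= C.

Definition test_function f := smooth f /\
  exists M : R, forall x, M < enorm x -> f x = 0.

Definition locally_integrable_rV f := measurable_fun [set: 'rV[R]_d] f /\
  forall K : set 'rV[R]_d, compact K ->
    (\int[lebesgue_rV R d]_(x in K) `|f x|%:E < +oo)%E.

Definition cintegrable (F : 'rV[R]_d -> R[i]) :=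
  (lebesgue_rV R d).-integrable setT (fun x => (complex.Re (F x))%:E) /\
  (lebesgue_rV R d).-integrable setT (fun x => (complex.Im (F x))%:E).

Definition cintegral (F : 'rV[R]_d -> R[i]) : R[i] :=
  ((\int[lebesgue_rV R d]_x complex.Re (F x)) +i*
   (\int[lebesgue_rV R d]_x complex.Im (F x)))%C.

Definition cexpNi (t : R) : R[i] := (cos t +i* - sin t)%C.

Definition fourier_cst : R := (2 * pi) `^ (- (d%:R / 2)).

Definition fourier f xi : R[i] :=
  (fourier_cst%:C * cintegral (fun x => (f x)%:C * cexpNi (dotrV x xi)))%C.

(* The (possibly non-integrable) locally integrable function f has Fourier
   transform w, in the sense of distributions: <f, F theta> = <w, theta>.
   Testing against compactly supported theta only, rather than against all
   Schwartz functions, does not presuppose that w is tempered. Integrability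
   of the w * theta forces w to be finite almost everywhere. *)
Definition is_fourier f (w : 'rV[R]_d -> \bar R) :=
  locally_integrable_rV f /\
  forall theta, test_function theta ->
    [/\ cintegrable (fun x => (f x)%:C * fourier theta x)%C,
        (lebesgue_rV R d).-integrable setT
          (fun xi => w xi * (theta xi)%:E)%E &
        cintegral (fun x => (f x)%:C * fourier theta x)%C =
        (fine (\int[lebesgue_rV R d]_xi (w xi * (theta xi)%:E))%E)%:C%C].

End euclidean.

Section cauchy_problem.
Variables (R : realType) (d : nat) (v0 : 'rV[R]_d -> R).

Definition picard_step (v : 'rV[R]_d -> R -> \bar R)
    (xi : 'rV[R]_d) (t : R) : \bar R :=
  ((expR (- (t * enorm xi ^+ 2)) * v0 xi)%:E +
   (fourier_cst R d)%:E *
   \int[@lebesgue_measure R]_(s in `[0%R, t])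
     ((expR (- (s * enorm xi ^+ 2)) * enorm xi)%:E *
      \int[lebesgue_rV R d]_eta (v eta (t - s)%R * v (xi - eta)%R (t - s)%R)))%E.

Definition picard (n : nat) : 'rV[R]_d -> R -> \bar R :=
  iter n picard_step (fun _ _ => 0%E).

Definition solution_fourier (xi : 'rV[R]_d) (t : R) : \bar R :=
  limn (fun n => picard n xi t).

(* u is the value at time t of the solution whose initial datum has Fourier
   transform v0 *)
Definition solution_at (t : R) (u : 'rV[R]_d -> R) :=
  is_fourier u (solution_fourier ^~ t).

End cauchy_problem.

Section besov.
Variables (R : realType) (d : nat) (phi : 'rV[R]_d -> R).

(* The order of R[i] compares only numbers with equal imaginary parts, so the
   first bound on fourier phi xi says that it is real and lies in [0, 1]. *)
Definition littlewood_paley :=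
  [/\ schwartz phi,
      forall xi, 0 <= fourier phi xi <= 1,
      forall xi, fourier phi xi != 0 -> 4^-1 <= enorm xi <= 1 &
      forall xi, xi != 0 ->
        (\esum_(j in [set: int])
          (complex.Re (fourier phi ((2 : R) ^ j *: xi)))%:E = 1)%E].

Definition dilate (j : int) (x : 'rV[R]_d) : R :=
  (2 : R) ^ (d%:Z * j) * phi ((2 : R) ^ j *: x).

(* infinite where the integral does not converge absolutely *)
Definition conv (g f : 'rV[R]_d -> R) (x : 'rV[R]_d) : \bar R :=
  (\int[lebesgue_rV R d]_y (g (x - y)%R * f y)%:E)%E.

Definition besov_norm (alpha : R) (f : 'rV[R]_d -> R) : \bar R :=
  ereal_sup [set ((2 `^ (alpha * j%:~R))%:E *
                  Lnorm (lebesgue_rV R d) +oo (conv (dilate j) f))%E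
            | j in [set: int]].

Definition besov (alpha : R) : set ('rV[R]_d -> R) :=
  [set f | locally_integrable_rV f /\ (besov_norm alpha f < +oo)%E].

End besov.

(* Main.v *)
Require Import Defs.
From mathcomp Require Import all_boot all_order all_algebra.
From mathcomp Require Import all_classical all_reals all_analysis.
From mathcomp Require Import measurable_realfun ess_sup_inf.
From mathcomp Require Import complex ring lra.

Set Implicit Arguments.
Unset Strict Implicit.
Unset Printing Implicit Defensive.

Import Order.TTheory GRing.Theory Num.Theory.
Import numFieldNormedType.Exports.

Local Open Scope classical_set_scope.
Local Open Scope ring_scope.

(** Write w for the Fourier transform of the solution at time 1. The theorem
holds because w is nonnegative away from the origin, so frequencies never
cancel, and because the quadratic interaction makes w doubly exponentially
large at dyadic frequencies when the datum is large.

Growth of w. Let an iterate v be at least A on a cube of side 2r about y, with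
y <> 0. For xi near 2y, both eta and xi - eta are near y whenever eta is near
xi / 2, so the interaction integral at xi is at least A^2 r^d. Integrating it
over a time window of length 3 * 4^-(n+1) when y = 2^n x0 costs only a bounded
heat factor, since |xi|^2 is of order 4^(n+1), and the windows have total
length 1. With A_n the lower bound on the cube about 2^n x0 this gives
A_(n+1) = kappa 2^-n A_n^2 for some constant kappa > 0, which is solved by
A_n = 2^(n+1) / kappa * 2^(2^n); a large datum,
damped by the heat flow up to time 1, is above A_0
([picard_step_ge], [gainS], [picard_growth], [solution_growth]).

Besov blocks. Let [window] be the Fourier transform of phi. The j-th block of
u at x is a positive constant times the integral of
w(xi) window(2^-j xi) cos(x.xi), for every x ([conv_dilate]). For x close to 0
the cosine is at least 1/2 on the support of the window, so the sup norm of the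
block controls the mass of w on any set where the window is bounded below
([block_lower_bound]). Some dyadic multiple 2^k x0 lies where the window is
positive; hence the block of index n - k sees the cube about 2^n x0, its sup
norm is at least a constant times A_n, and no power 2^(- alpha n) can bound
that ([double_exponential_unbounded]).

From the weak Fourier transform to [conv_dilate]. The transform of u is known
only through pairings with compactly supported smooth functions. The ones used
are window(2^-j xi) cos(x.xi + delta). As phi is real and its transform is
real, such a product is again a single integral of phi against a cosine
([window_phase]), and integrals of this kind are smooth because differentiation
reproduces them with another weight and a phase shift ([cosint_smooth]). Their
own Fourier transforms recombine into the kernel of the block by Fourier
inversion for phi ([cos_inversion]). Inversion is Abel summation: damping by
the product of the exp(- e |xi_i|) turns the cosine integral into an average of
phi against a product of Poisson kernels, and e tends to 0. *)

(** * Integral comparison without measurability *)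

Section integral_off_null_set.
Local Open Scope ereal_scope.
Context d (T : measurableType d) (R : realType).
Variables (mu : {measure set T -> \bar R}) (N : set T).
Hypotheses (mN : measurable N) (N0 : mu N = 0).

Import HBNNSimple.

(** No measurability is required: the integral of a nonnegative function is the
supremum over the simple functions below it, and cutting such a simple function
off on the null set [N] does not change its integral. This is what makes the
Picard iterates, whose measurability is unknown, comparable. *)
Lemma ge0_le_integral_off_null (f g : T -> \bar R) :
  (forall x, 0 <= f x) -> (forall x, 0 <= g x) ->
  (forall x, ~ N x -> f x <= g x) -> \int[mu]_x f x <= \int[mu]_x g x.
Proof.
move=> f0 g0 fg; rewrite ge0_integralTE//; apply: ge_ereal_sup => _ [h hf <-].
have mNC : measurable (~` N) by exact: measurableC.
have -> : sintegral mu h = sintegral mu (proj_nnsfun h mNC).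
  rewrite -[LHS](integralT_nnsfun mu) -[RHS](integralT_nnsfun mu).
  apply: ae_eq_integral => //; [exact/measurable_EFinP|exact/measurable_EFinP|].
  exists N; split => // x /= hx; apply: contrapT => Nx; apply: hx => _.
  by rewrite mindicE mem_set ?mulr1.
rewrite ge0_integralTE//; apply: ereal_sup_ubound.
exists (proj_nnsfun h mNC) => //= x; rewrite mindicE.
have [Nx|Nx] := boolP (x \in ~` N); rewrite ?mulr1 ?mulr0//.
exact: le_trans (hf x) (fg x (set_mem Nx)).
Qed.

(** Allows functions that are negative on the null set, as happens at the
origin, where the sign of the datum is not prescribed. *)
Lemma le_integral_off_null (f g : T -> \bar R) :
  (forall x, ~ N x -> 0 <= f x <= g x) -> \int[mu]_x f x <= \int[mu]_x g x.
Proof.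
move=> fg; rewrite [leLHS]integralE [leRHS]integralE.
have -> : \int[mu]_x g^\- x = 0.
  apply/eqP; rewrite eq_le integral_ge0// andbT.
  rewrite -[leRHS](integral0 mu setT).
  apply: ge0_le_integral_off_null => // x /fg /andP[f0 fgx].
  by rewrite funenegE ge_max lexx andbT leeNl oppe0 (le_trans f0).
rewrite sube0; apply: (@le_trans _ _ (\int[mu]_x f^\+ x)).
  by rewrite -[leRHS]adde0 leeD// oppe_le0 integral_ge0.
apply: ge0_le_integral_off_null => // x /fg /andP[_ ?].
by rewrite !funeposE; exact: le_max2.
Qed.

Lemma cst_le_integral (D B : set T) (c : R) (f : T -> \bar R) :
  measurable B -> B `<=` D -> (0 <= c)%R ->
  (forall x, D x -> ~ N x -> 0 <= f x) ->
  (forall x, B x -> ~ N x -> c%:E <= f x) ->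
  c%:E * mu B <= \int[mu]_(x in D) f x.
Proof.
move=> mB BD c0 f0 cf; rewrite -integral_cst// integral_mkcond.
rewrite [leRHS]integral_mkcond; apply: le_integral_off_null => x Nx.
rewrite /patch; have [/set_mem Bx|_] := boolP (x \in B).
  by rewrite mem_set ?lee_fin ?c0 ?cf//; exact: BD.
by case: ifPn => [/set_mem Dx|]; rewrite lexx// f0.
Qed.

End integral_off_null_set.

(** * Cubes and the Euclidean norm *)

Section cubes.
Variables (R : realType).

Lemma measurable_box n (a b : 'rV[R]_n) :
  measurable [set x : 'rV[R]_n | forall i, x 0 i \in `[a 0 i, b 0 i]].
Proof.
rewrite (_ : mkset _ = \big[setI/setT]_(i < n) ((fun x : 'rV[R]_n => x 0 i) @^-1`
     `[a 0 i, b 0 i]%classic)).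
  apply: bigsetI_measurable => i _; rewrite -[X in measurable X]setTI.
  by apply: (measurable_coord i measurableT); exact: measurable_itv.
apply/seteqP; split => x /=.
  by move=> xi; rewrite -bigcap_seq => i _ /=; exact: xi.
by rewrite -bigcap_seq => xi i; apply: (xi i); rewrite /= mem_index_enum.
Qed.

Definition cube n (y : 'rV[R]_n) (r : R) : set 'rV[R]_n :=
  [set x | forall i, `|x 0 i - y 0 i| <= r].

Lemma cubeE n (y : 'rV[R]_n) (r : R) : cube y r =
  [set x : 'rV[R]_n | forall i, x 0 i \in `[(y - const_mx r) 0 i, (y + const_mx r) 0 i]].
Proof.
by apply/seteqP; split => x xr i; have := xr i; rewrite !mxE in_itv/= ler_distl.
Qed.

Lemma measurable_cube n (y : 'rV[R]_n) r : measurable (cube y r).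
Proof. by rewrite cubeE; exact: measurable_box. Qed.

Lemma lebesgue_cube n (y : 'rV[R]_n) r : 0 <= r ->
  lebesgue_rV R n (cube y r) = ((2 * r) ^+ n)%:E.
Proof.
move=> r0; rewrite cubeE lebesgue_rV_box; last first.
  by move=> i; rewrite !mxE lerD2l ge0_cp.
under eq_bigr do rewrite !mxE opprD opprK addrACA subrr add0r -mulr2n -mulr_natl.
by rewrite prodr_const card_ord.
Qed.

Lemma cube0 n (y : 'rV[R]_n) : cube y 0 = [set y].
Proof.
apply/seteqP; split => x /= => [xy|->]; last by move=> i; rewrite subrr normr0.
by apply/rowP => i; apply/eqP; rewrite -subr_eq0 -normr_le0; exact: xy.
Qed.

Lemma lebesgue_set1_rV n (y : 'rV[R]_n) : (0 < n)%N -> lebesgue_rV R n [set y] = 0%E.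
Proof. by move=> n0; rewrite -cube0 lebesgue_cube// mulr0 expr0n gtn_eqF. Qed.

Lemma measurable_set1_rV n (y : 'rV[R]_n) : measurable [set y].
Proof. by rewrite -cube0; exact: measurable_cube. Qed.

End cubes.

Section euclidean_norm.
Variables (R : realType) (d : nat).

Lemma fourier_cst_ge0 : 0 <= fourier_cst R d.
Proof. exact: powR_ge0. Qed.

Lemma fourier_cst_gt0 : 0 < fourier_cst R d.
Proof. by apply: powR_gt0; rewrite mulr_gt0// pi_gt0. Qed.

Lemma enorm_ge0 (xi : 'rV[R]_d) : 0 <= enorm xi.
Proof. exact: sqrtr_ge0. Qed.

Lemma enorm_sqr (x : 'rV[R]_d) : enorm x ^+ 2 = \sum_(i < d) x 0 i ^+ 2.
Proof.
rewrite sqr_sqrtr; first by apply: eq_bigr => i _; rewrite expr2.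
by apply: sumr_ge0 => i _; rewrite -expr2 sqr_ge0.
Qed.

Lemma enormZ (a : R) (x : 'rV[R]_d) : enorm (a *: x) = `|a| * enorm x.
Proof.
apply/eqP; rewrite -(@eqrXn2 _ 2)// ?mulr_ge0 ?enorm_ge0//.
rewrite exprMn !enorm_sqr real_normK ?num_real// mulr_sumr.
by apply/eqP/eq_bigr => i _; rewrite mxE exprMn.
Qed.

Lemma le_coord_enorm (x : 'rV[R]_d) i : `|x 0 i| <= enorm x.
Proof.
rewrite -(@ler_pXn2r _ 2) ?nnegrE ?enorm_ge0// real_normK ?num_real//.
rewrite enorm_sqr (bigD1 i)//= lerDl.
by apply: sumr_ge0 => j _; rewrite sqr_ge0.
Qed.

Lemma enorm_le_sum (x : 'rV[R]_d) : enorm x <= \sum_(i < d) `|x 0 i|.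
Proof.
have s0 : 0 <= \sum_(i < d) `|x 0 i| by apply: sumr_ge0.
rewrite -(@ler_pXn2r _ 2) ?nnegrE ?enorm_ge0// enorm_sqr.
rewrite expr2 mulr_suml; apply: ler_sum => i _.
rewrite -real_normK ?num_real// expr2 ler_wpM2l//.
by rewrite (bigD1 i)//= lerDl sumr_ge0.
Qed.

Lemma scale_cube n (x0 xi : 'rV[R]_d) (r : R) : 0 <= r ->
  cube (2 ^+ n *: x0) r xi -> cube x0 r (2 ^- n *: xi).
Proof.
move=> r0 xix i; have := xix i; rewrite !mxE => h.
have p2 : 0 < 2 ^+ n :> R by rewrite exprn_gt0.
rewrite -(@ler_pM2l _ (2 ^+ n))// -[X in X * `|_|]ger0_norm ?(ltW p2)//.
rewrite -normrM mulrBr mulrA divff ?gt_eqF// mul1r (le_trans h)//.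
by rewrite ler_peMl// exprn_ege1// ler1n.
Qed.

End euclidean_norm.

(** * Growth of the Picard iterates *)

Section cascade.
Variables (R : realType) (d : nat) (d0 : (0 < d)%N) (v0 : 'rV[R]_d -> R).
Hypothesis v0_ge0 : forall xi, xi != 0 -> 0 <= v0 xi.

Implicit Types v w : 'rV[R]_d -> R -> \bar R.

(* The integrand v(eta) v(xi - eta) may be negative only where one of the two
   arguments vanishes. *)
Let null2 (xi : 'rV[R]_d) : lebesgue_rV R d ([set 0] `|` [set xi]) = 0%E.
Proof.
by apply: null_set_setU;
  [exact: measurable_set1_rV|exact: measurable_set1_rV
  |exact: lebesgue_set1_rV|exact: lebesgue_set1_rV].
Qed.

Let mnull2 (xi : 'rV[R]_d) : measurable ([set 0] `|` [set xi]).
Proof. by apply: measurableU; exact: measurable_set1_rV. Qed.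

Let off_null2 (xi eta : 'rV[R]_d) :
  ~ ([set 0] `|` [set xi]) eta -> eta != 0 /\ xi - eta != 0.
Proof.
move=> /not_orP[/eqP ? /eqP ne]; split => //.
by rewrite subr_eq0 eq_sym.
Qed.

Definition ge0_off0 v := forall xi t, xi != 0 -> (0 <= v xi t)%E.

Lemma interaction_ge0 v xi t : ge0_off0 v ->
  (0 <= \int[lebesgue_rV R d]_eta (v eta t * v (xi - eta)%R t))%E.
Proof.
move=> v_ge0; rewrite -[leLHS](integral0 (lebesgue_rV R d) setT).
apply: (le_integral_off_null (mnull2 xi) (null2 xi)) => eta /off_null2[eta0 xieta0].
by rewrite lexx mule_ge0// v_ge0.
Qed.

Lemma le_interaction v w xi t : ge0_off0 v ->
  (forall eta t, eta != 0 -> (v eta t <= w eta t)%E) ->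
  (\int[lebesgue_rV R d]_eta (v eta t * v (xi - eta)%R t) <=
   \int[lebesgue_rV R d]_eta (w eta t * w (xi - eta)%R t))%E.
Proof.
move=> v_ge0 vw.
apply: (le_integral_off_null (mnull2 xi) (null2 xi)) => eta /off_null2[eta0 xieta0].
by rewrite mule_ge0 ?v_ge0// lee_pmul ?v_ge0 ?vw.
Qed.

Lemma heat_factor_ge0 s (xi : 'rV[R]_d) :
  (0 <= (expR (- (s * enorm xi ^+ 2)) * enorm xi)%:E)%E.
Proof. by rewrite lee_fin mulr_ge0 ?expR_ge0 ?enorm_ge0. Qed.

Lemma picard_step_ge0 v : ge0_off0 v -> ge0_off0 (picard_step v0 v).
Proof.
move=> v_ge0 xi t xi0; rewrite /picard_step adde_ge0//.
  by rewrite lee_fin mulr_ge0 ?expR_ge0 ?v0_ge0.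
rewrite mule_ge0 ?lee_fin ?fourier_cst_ge0// integral_ge0// => s _.
by rewrite mule_ge0 ?heat_factor_ge0// (interaction_ge0 _ (t - s)).
Qed.

Lemma le_picard_step v w : ge0_off0 v ->
  (forall xi t, xi != 0 -> (v xi t <= w xi t)%E) ->
  forall xi t, xi != 0 -> (picard_step v0 v xi t <= picard_step v0 w xi t)%E.
Proof.
move=> v_ge0 vw xi t xi0; rewrite /picard_step leeD2l// lee_wpmul2l//.
  by rewrite lee_fin fourier_cst_ge0.
rewrite integral_mkcond [leRHS]integral_mkcond.
apply: (@le_integral_off_null _ _ _ _ set0) => // s _.
rewrite /patch; case: ifPn => _; last by rewrite lexx.
rewrite mule_ge0 ?heat_factor_ge0//=; last exact: (interaction_ge0 _ (t - s)).
by rewrite lee_wpmul2l ?heat_factor_ge0//; exact: (le_interaction _ (t - s)).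
Qed.

Lemma picard_ge0 n : ge0_off0 (picard v0 n).
Proof. by elim: n => // n IHn; exact: picard_step_ge0. Qed.

Lemma picard_nondecreasing xi t : xi != 0 ->
  nondecreasing_seq (fun n => picard v0 n xi t).
Proof.
move=> xi0; apply/nondecreasing_seqP => n.
elim: n xi t xi0 => [|n IHn] xi t xi0; first exact: picard_ge0.
by apply: le_picard_step => //; exact: picard_ge0.
Qed.

Lemma picard_le_solution n xi t : xi != 0 ->
  (picard v0 n xi t <= solution_fourier v0 xi t)%E.
Proof.
move=> xi0; rewrite /solution_fourier.
have /cvg_lim -> // := ereal_nondecreasing_cvgn (picard_nondecreasing t xi0).
by apply: ereal_sup_ubound; exists n.
Qed.

(** The elementary gain: a lower bound [A] near [y] during a time [dt] becomes a
quadratic lower bound near [2 y]. If [eta] is within [r / 2] of [xi / 2], then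
so is [xi - eta], and both are within [r] of [y]. *)
Lemma picard_step_ge v (xi y : 'rV[R]_d) (t t0 dt A r : R) : ge0_off0 v -> xi != 0 ->
  0 <= A -> 0 <= r -> 0 <= dt -> dt <= t - t0 ->
  (forall eta (s : R), cube y r eta -> t0 <= s <= t -> (A%:E <= v eta s)%E) ->
  cube (2 *: y) r xi -> 0 <= t0 ->
  ((fourier_cst R d *
    (expR (- (dt * enorm xi ^+ 2)) * enorm xi * (A ^+ 2 * r ^+ d) * dt))%:E
   <= picard_step v0 v xi t)%E.
Proof.
move=> v_ge0 xi0 A0 r0 dt_ge0 dtt Av xiy t0_ge0.
rewrite /picard_step -[leLHS]add0e leeD//.
  by rewrite lee_fin mulr_ge0 ?expR_ge0 ?v0_ge0.
rewrite EFinM lee_wpmul2l ?lee_fin ?fourier_cst_ge0//.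
set c := (X in (X * dt)%:E).
have c0 : 0 <= c by rewrite !mulr_ge0 ?expR_ge0 ?enorm_ge0 ?exprn_ge0.
have -> : (c * dt)%:E = (c%:E * @lebesgue_measure R `[0%R, dt]%classic)%E.
  rewrite lebesgue_measure_itv/= lte_fin oppr0 adde0.
  by case: (ltgtP 0 dt) dt_ge0 => // <- _; rewrite mulr0 mule0.
apply: (@cst_le_integral _ _ _ _ set0) => //.
- move=> s /=; rewrite !in_itv/= => /andP[-> sdt].
  by rewrite (le_trans sdt)// (le_trans dtt)// ler_wnDr// oppr_le0.
- move=> s _ _; rewrite mule_ge0 ?heat_factor_ge0//.
  exact: (interaction_ge0 _ (t - s)).
move=> s /=; rewrite in_itv/= => /andP[s0 sdt] _.
rewrite /c EFinM lee_pmul//; first exact: heat_factor_ge0.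
- by rewrite lee_fin mulr_ge0// exprn_ge0.
- rewrite lee_fin ler_wpM2r ?enorm_ge0// ler_expR lerN2 ler_wpM2r//.
  exact: sqr_ge0.
have -> : (A ^+ 2 * r ^+ d)%:E =
    ((A ^+ 2)%:E * lebesgue_rV R d (cube (2^-1 *: xi) (r / 2)))%E.
  rewrite lebesgue_cube ?divr_ge0// -EFinM; congr (_ * _ ^+ _)%:E.
  by rewrite mulrCA divff// mulr1.
have near_y eta : cube (2^-1 *: xi) (r / 2) eta -> cube y r eta.
  move=> etaxi i; have := etaxi i; have := xiy i; rewrite !mxE !ler_distl.
  by lra.
have ts : t0 <= t - s <= t by lra.
apply: (cst_le_integral (mnull2 xi) (null2 xi)) => //.
- exact: measurable_cube.
- exact: exprn_ge0.
- by move=> eta _ /off_null2[eta0 xieta0]; rewrite mule_ge0 ?v_ge0.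
move=> eta etaxi _; rewrite expr2 EFinM lee_pmul ?lee_fin//.
  by apply: Av => //; exact: near_y.
apply: Av => //; apply: near_y => i; have := etaxi i; rewrite !mxE !ler_distl.
by lra.
Qed.

(** The constant kappa of the recursion A_(n+1) = kappa 2^-n A_n^2: heat factor,
frequency times length of the time window, and volume of the interacting cube. *)
Definition gain_rate (r rho M : R) :=
  fourier_cst R d * expR (- (3 * M ^+ 2)) * (3 / 2 * rho) * r ^+ d.

(** The solution of this recursion with A_0 = 4 / kappa. *)
Definition gain (r rho M : R) n : R :=
  2 ^+ n.+1 / gain_rate r rho M * 2 ^+ (2 ^ n).

Lemma gain_rate_gt0 r rho M : 0 < r -> 0 < rho -> 0 < gain_rate r rho M.
Proof.
move=> r0 rho0.
by rewrite !mulr_gt0 ?fourier_cst_gt0 ?expR_gt0 ?exprn_gt0 ?invr_gt0.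
Qed.

Lemma gainS r rho M n : 0 < r -> 0 < rho ->
  gain r rho M n.+1 = gain_rate r rho M * 2 ^- n * gain r rho M n ^+ 2.
Proof.
move=> r0 rho0; have k0 := gain_rate_gt0 M r0 rho0.
have p2 : 2 ^+ n != 0 :> R by rewrite expf_neq0.
rewrite /gain expnS mul2n -addnn exprD !exprS.
by field; rewrite p2 gt_eqF.
Qed.

(** The time threshold [1 - 4 ^- n] leaves a window of length [3 * 4 ^- n.+1]
before the next one. Over it the heat factor at frequencies of size at most
[2 ^+ n.+1 * M] is at least [expR (- (3 * M ^+ 2))], and all thresholds stay
below time 1. *)
Lemma picard_growth (x0 : 'rV[R]_d) r rho M : 0 < r -> 0 < rho ->
  (forall xi, cube x0 r xi -> rho <= enorm xi <= M) ->
  (forall xi, cube x0 r xi -> gain r rho M 0 * expR (M ^+ 2) <= v0 xi) ->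
  forall n xi (t : R), cube (2 ^+ n *: x0) r xi -> 1 - 4 ^- n <= t <= 1 ->
  ((gain r rho M n)%:E <= picard v0 n.+1 xi t)%E.
Proof.
move=> r0 rho0 x0M v0M; have k0 := gain_rate_gt0 M r0 rho0.
have g0 n : 0 <= gain r rho M n.
  by rewrite /gain mulr_ge0 ?exprn_ge0 ?divr_ge0 ?exprn_ge0 ?ltW.
have cubeM n xi : cube (2 ^+ n *: x0) r xi ->
    2 ^+ n * rho <= enorm xi <= 2 ^+ n * M.
  move=> /(scale_cube (ltW r0)) /x0M; rewrite enormZ normfV normrX.
  have p2 : 0 < 2 ^+ n :> R by rewrite exprn_gt0.
  by rewrite (@ger0_norm _ 2)// ler_pdivlMl// ler_pdivrMl//.
have cube_neq0 n xi : cube (2 ^+ n *: x0) r xi -> xi != 0.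
  move=> /cubeM /andP[+ _]; apply: contraTneq => ->.
  rewrite -ltNge (_ : enorm 0 = 0) ?mulr_gt0 ?exprn_gt0//.
  by rewrite -(scale0r 0) enormZ normr0 mul0r.
elim=> [|n IHn] xi t xix /andP[t0 t1].
  (* the first iterate is the heat flow of the datum, since v = 0 interacts to 0 *)
  have xi0 := cube_neq0 _ _ xix.
  rewrite /= /picard_step -[leLHS]adde0 leeD//; last first.
    rewrite mule_ge0 ?lee_fin ?fourier_cst_ge0// integral_ge0// => s _.
    rewrite mule_ge0 ?heat_factor_ge0//.
    exact: (@interaction_ge0 (fun _ _ => 0%E) xi (t - s)).
  have /andP[_] := cubeM _ _ xix; rewrite expr0 mul1r scale1r in xix *.
  move=> xiM; rewrite lee_fin -[leLHS]mul1r -[X in X * _](expRxMexpNx_1 (M ^+ 2)).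
  rewrite mulrAC mulrC ler_pM ?expR_ge0 ?(mulr_ge0 (g0 _)) ?expR_ge0//.
    by rewrite mulrC mulr_ge0 ?expR_ge0.
    rewrite ler_expR lerN2 -[leRHS]mul1r.
    apply: ler_pM => //; rewrite ?sqr_ge0//; first by move: t0; rewrite expr0 invr1 subrr.
    by rewrite ler_pXn2r ?nnegrE ?enorm_ge0// (le_trans (enorm_ge0 xi)).
  by rewrite mulrC; exact: v0M.
have xi0 := cube_neq0 _ _ xix; have /andP[rhoxi xiM] := cubeM _ _ xix.
have M0 : 0 <= M.
  have /x0M/andP[+ +] : cube x0 r x0 by move=> i; rewrite subrr normr0 ltW.
  by move=> _; apply: le_trans; exact: enorm_ge0.
set dt : R := 3 * 4 ^- n.+1.
have dt0 : 0 <= dt by rewrite mulr_ge0// invr_ge0 exprn_ge0.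
have q0 : (0 : R) < 4 ^- n by rewrite invr_gt0 exprn_gt0.
have q1 : 4 ^- n <= 1 :> R by rewrite invf_le1 ?exprn_gt0// exprn_ege1// ler1n.
have dtE : dt = 3 / 4 * 4 ^- n by rewrite /dt exprSr invfM mulrA mulrAC.
have q4 : 4 ^- n.+1 = 4^-1 * 4 ^- n :> R by rewrite exprS invfM.
apply: le_trans (@picard_step_ge (picard v0 n.+1) xi (2 ^+ n *: x0) t
  (1 - 4 ^- n) dt (gain r rho M n) r _ xi0 (g0 n) (ltW r0) dt0 _ _ _ _).
- rewrite lee_fin gainS//.
  have e0 : expR (- (3 * M ^+ 2)) <= expR (- (dt * enorm xi ^+ 2)).
    rewrite ler_expR lerN2 /dt -mulrA ler_wpM2l//.
    rewrite ler_pdivrMl ?exprn_gt0// (_ : 4 = 2 ^+ 2); last by rewrite expr2; lra.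
    rewrite -exprM mulnC exprM -exprMn ler_pXn2r ?nnegrE ?enorm_ge0//.
    by rewrite mulr_ge0 ?exprn_ge0.
  have xidt : 3 / 2 * rho * 2 ^- n <= enorm xi * dt.
    have -> : 3 / 2 * rho * 2 ^- n = (2 ^+ n.+1 * rho) * dt.
      rewrite dtE (_ : 4 = 2 ^+ 2); last by rewrite expr2; lra.
      rewrite -exprM mulnC exprM expr2 exprS; field.
      by rewrite expf_neq0.
    by rewrite ler_wpM2r.
  rewrite /gain_rate.
  have -> : fourier_cst R d * expR (- (3 * M ^+ 2)) * (3 / 2 * rho) * r ^+ d /
      2 ^+ n * gain r rho M n ^+ 2 = fourier_cst R d * (expR (- (3 * M ^+ 2)) *
      (3 / 2 * rho / 2 ^+ n) * (gain r rho M n ^+ 2 * r ^+ d)) by ring.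
  rewrite ler_wpM2l ?fourier_cst_ge0//.
  rewrite [leRHS]mulrAC -(mulrA (expR _) (enorm xi)).
  rewrite ler_wpM2r//.
    by apply: mulr_ge0; rewrite exprn_ge0// ltW.
  apply: ler_pM => //; rewrite ?expR_ge0// !mulr_ge0 ?invr_ge0 ?exprn_ge0//.
  exact: ltW.
- exact: picard_ge0.
- by rewrite dtE; move: t0; rewrite q4; lra.
- move=> eta s etax /andP[t0s st]; apply: IHn => //.
  by rewrite t0s (le_trans st).
- by rewrite scalerA -exprS.
- by rewrite subr_ge0.
Qed.

Lemma solution_growth (x0 : 'rV[R]_d) (r rho M : R) : 0 < r -> 0 < rho ->
  (forall xi, cube x0 r xi -> rho <= enorm xi <= M) ->
  (forall xi, cube x0 r xi -> gain r rho M 0 * expR (M ^+ 2) <= v0 xi) ->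
  forall n xi, cube (2 ^+ n *: x0) r xi -> xi != 0 ->
  ((gain r rho M n)%:E <= solution_fourier v0 xi 1)%E.
Proof.
move=> r0 rho0 x0M v0M n xi xix xi0.
apply: le_trans (picard_le_solution n.+1 1 xi0).
apply: (picard_growth r0 rho0 x0M v0M) => //.
by rewrite lexx andbT gerBl invr_ge0 exprn_ge0.
Qed.

Lemma solution_ge0 (xi : 'rV[R]_d) (t : R) : xi != 0 ->
  (0 <= solution_fourier v0 xi t)%E.
Proof. by move=> xi0; exact: le_trans (picard_le_solution 0 t xi0). Qed.

End cascade.

(** * Measure theory on row vectors *)

Section borel_rV_facts.
Variables (R : realType).

(** The sigma-algebra is generated by the coordinates, so an open set has to be
exhibited as a countable union of boxes: the cubes with rational center and
radius [1 / (m + 1)] that it contains. *)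
Lemma open_measurable_rV n (U : set 'rV[R]_n) : open U -> measurable U.
Proof.
move=> oU.
pose Q (p : 'rV[rat]_n * nat) : set 'rV[R]_n := cube (map_mx ratr p.1) p.2.+1%:R^-1.
pose good := [set p | Q p `<=` U].
rewrite (_ : U = \bigcup_(p in good) Q p); last first.
  apply/seteqP; split => [x Ux|x [p /= + Qx]]; last exact.
  have /nbhs_ballP[e /= e0 xeU] : nbhs x U by exact: open_nbhs_nbhs.
  have [m me] : exists m : nat, m.+1%:R^-1 < e / 2.
    have := @near_infty_natSinv_lt R (PosNum (divr_gt0 e0 (ltr0n _ 2))).
    by move=> [m _ /(_ m (leqnn m))]; exists m.
  have m0 : (0 : R) < m.+1%:R^-1 by rewrite invr_gt0.
  have /all_sig[q qx] (i : 'I_n) : {q : rat | x 0 i - m.+1%:R^-1 < ratr q < x 0 i + m.+1%:R^-1}.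
    apply: cid.
    have [|q] := @rat_in_itvoo R (x 0 i - m.+1%:R^-1) (x 0 i + m.+1%:R^-1).
      by rewrite ltrD2l gtrN.
    by rewrite in_itv/=; exists q.
  exists (\row_i q i, m); last first.
    move=> i; rewrite !mxE /= ler_distl; move: m0 (qx i); set k := (_^-1); lra.
  move=> y yQ; apply: xeU; split => // i j; rewrite ord1.
  rewrite -ball_normE /= distrC; have := yQ j; have := qx j; rewrite !mxE/=.
  by rewrite ler_distl ltr_distl; move: me; set k := (m.+1%:R^-1); lra.
rewrite (_ : \bigcup_(p in good) Q p = \bigcup_p (if p \in good then Q p else set0)).
  apply: countable_bigcupT_measurable; first exact: countableP.
  by move=> p; case: ifP => // _; exact: measurable_cube.
apply/seteqP; split => x.
  by move=> [p gp Qpx]; exists p => //; rewrite mem_set.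
by move=> [p _]; case: ifP => // /set_mem gp Qpx; exists p.
Qed.

Lemma continuous_measurable_rV n (f : 'rV[R]_n -> R) :
  continuous f -> measurable_fun setT (f : 'rV[R]_n -> measurableTypeR R).
Proof.
move=> cf; apply: (measurability _ (RGenOInfty.measurableE R)).
move=> _ [_ [a ->] <-]; rewrite setTI; apply: open_measurable_rV.
by move/continuousP : cf; apply; exact: interval_open.
Qed.

End borel_rV_facts.

Section iterated_integral.
Variables (R : realType).
Local Open Scope ereal_scope.
Local Notation lambda := (@lebesgue_measure R).

Lemma ge0_integral_consrV n (F : 'rV[R]_n.+1 -> \bar R) :
  measurable_fun setT F -> (forall x, 0 <= F x) ->
  \int[lebesgue_rV R n.+1]_x F x =
  \int[lambda]_s \int[lebesgue_rV R n]_v F (consrV (s, v)).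
Proof.
move=> mF F0.
have mc := @measurable_consrV R n.
transitivity (\int[lambda \x lebesgue_rV R n]_p F (consrV p)).
  exact: (@ge0_integral_pushforward _ _ _ _ R _ mc (lambda \x lebesgue_rV R n)
    setT F).
rewrite fubini_tonelli1//; exact: measurableT_comp.
Qed.

Lemma splitrVK n : cancel (@splitrV R n) (@consrV R n).
Proof.
move=> x; apply/rowP => i; rewrite mxE/=.
by case: unliftP => [j ->|->] //=; rewrite mxE.
Qed.

Lemma integrable_consrV n (F : 'rV[R]_n.+1 -> \bar R) :
  (lebesgue_rV R n.+1).-integrable setT F <->
  (lambda \x lebesgue_rV R n).-integrable setT (F \o @consrV R n).
Proof.
have mc := @measurable_consrV R n.
have E (G : 'rV[R]_n.+1 -> \bar R) : measurable_fun setT G ->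
    \int[lebesgue_rV R n.+1]_x `|G x| =
    \int[lambda \x lebesgue_rV R n]_p `|G (consrV p)|.
  move=> mG; apply: (@ge0_integral_pushforward _ _ _ _ R _ mc
    (lambda \x lebesgue_rV R n) setT (abse \o G)) => //.
    exact: measurableT_comp.
  by move=> y _; exact: abse_ge0.
have mE : measurable_fun setT F <-> measurable_fun setT (F \o @consrV R n).
  split=> [mF|mFc]; first exact: measurableT_comp.
  rewrite (_ : F = (F \o @consrV R n) \o @splitrV R n).
    by apply: measurableT_comp => //; exact: measurable_splitrV.
  by apply/funext => x /=; rewrite splitrVK.
by split=> /integrableP[/mE mF Foo]; apply/integrableP; split=> //;
  [rewrite /= -E//; exact/mE | rewrite E//; exact/mE].
Qed.

Lemma integral_consrV n (F : 'rV[R]_n.+1 -> \bar R) :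
  (lebesgue_rV R n.+1).-integrable setT F ->
  \int[lebesgue_rV R n.+1]_x F x =
  \int[lambda]_s \int[lebesgue_rV R n]_v F (consrV (s, v)).
Proof.
move=> iF; have mF := measurable_int _ iF; have mc := @measurable_consrV R n.
have iFc := (integrable_consrV F).1 iF.
transitivity (\int[lambda \x lebesgue_rV R n]_p (F \o @consrV R n) p); last first.
  by rewrite -integral12_prod_meas1.
exact: (@integral_pushforward _ _ _ _ R _ mc (lambda \x lebesgue_rV R n) setT F).
Qed.

End iterated_integral.

Section affine_change_of_variables.
Variables (R : realType).
Local Open Scope ereal_scope.
Local Notation lambda := (@lebesgue_measure R).

Lemma measurable_affine1 (a b : R) :
  measurable_fun setT (fun s : measurableTypeR R => (a * s + b)%R : measurableTypeR R).
Proof. by apply: measurable_funD => //; exact: measurable_funM. Qed.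

Lemma ge0_integral_affine1 (a b : R) (F : R -> \bar R) : (0 < a)%R ->
  measurable_fun setT (F : measurableTypeR R -> \bar R) -> (forall x, 0 <= F x) ->
  \int[lambda]_s F (a * s + b)%R = (a^-1)%:E * \int[lambda]_s F s.
Proof.
move=> a0 mF F0.
pose m0 : {measure set (measurableTypeR R) -> \bar R} :=
  measure_function_pushforward__canonical__measure_function_Measure
  lambda (measurable_affine1 a b).
have lam A : measurable A -> lambda A = mscale (NngNum (ltW a0)) m0 A.
  apply: lebesgue_measure_unique => _ [[p q]] _ <- /=.
  rewrite /mscale /= /pushforward.
  rewrite (_ : _ @^-1` _ = `](p - b) / a, (q - b) / a]%classic)%R; last first.
    apply/seteqP; split => x /=; rewrite !in_itv/= ltr_pdivrMr// ler_pdivlMr//;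
      by rewrite ltrBlDr lerBrDr mulrC.
  rewrite !lebesgue_measure_itv/= !lte_fin ltr_pM2r ?invr_gt0// ltrD2r.
  case: ifPn => _; last by rewrite mule0.
  by rewrite -!EFinB -EFinM; congr EFin; field; rewrite gt_eqF.
rewrite [X in _ * X](eq_measure_integral (mscale (NngNum (ltW a0)) m0)); last first.
  by move=> A mA _; exact: lam.
rewrite ge0_integral_mscale// muleA -EFinM /= mulVf ?gt_eqF// mul1e.
exact/esym/(@ge0_integral_pushforward _ _ _ _ R _ (measurable_affine1 a b) lambda setT F).
Qed.

Lemma measurable_affine n (a : R) (b : 'rV[R]_n) :
  measurable_fun setT (fun x : 'rV[R]_n => (a *: x + b)%R).
Proof.
apply: measurable_fun_rVP => i; under eq_fun do rewrite !mxE.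
apply: measurable_funD => //; apply: measurable_funM => //.
exact: measurable_coord.
Qed.

(** By induction on the dimension: the affine map acts on the first coordinate
and on the remaining ones separately, so Tonelli reduces it to the line. *)
Lemma ge0_integral_affine n (a : R) (b : 'rV[R]_n) (F : 'rV[R]_n -> \bar R) :
  (0 < a)%R -> measurable_fun setT F -> (forall x, 0 <= F x) ->
  \int[lebesgue_rV R n]_x F (a *: x + b)%R =
  (a ^- n)%:E * \int[lebesgue_rV R n]_x F x.
Proof.
move=> a0; elim: n b F => [|n IHn] b F mF F0.
  rewrite expr0 invr1 mul1e; apply: eq_integral => x _; congr F.
  by apply/rowP => -[].
have ma := measurable_affine a b.
rewrite ge0_integral_consrV//; last exact: (measurableT_comp mF ma).
pose b' : 'rV[R]_n := (\row_j b 0 (lift ord0 j))%R.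
have split_affine s v : (a *: consrV (s, v) + b =
    consrV (a * s + b 0%R ord0, a *: v + b') :> 'rV[R]_n.+1)%R.
  apply/rowP => i; rewrite !mxE /=.
  by case: unliftP => [j ->|->] //=; rewrite !mxE.
have mFc : measurable_fun setT (F \o @consrV R n).
  by apply: measurableT_comp => //; exact: measurable_consrV.
transitivity (\int[lambda]_s ((a ^- n)%:E *
    \int[lebesgue_rV R n]_v F (consrV ((a * s + b 0%R ord0)%R, v)))).
  apply: eq_integral => s _; under eq_integral do rewrite split_affine.
  rewrite (IHn b' (fun v => F (consrV ((a * s + b 0%R ord0)%R, v))))//.
  exact: (measurableT_comp mFc (@measurable_pair1 _ _ _ _ _)).
have mG : measurable_fun setT (fun s : measurableTypeR R =>
    \int[lebesgue_rV R n]_v F (consrV (s, v))).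
  apply: (@measurable_fun_fubini_tonelli_F _ _ _ _ R (lebesgue_rV R n) (F \o @consrV R n)) => // p.
  exact: F0.
have G0 s : 0 <= \int[lebesgue_rV R n]_v F (consrV (s, v)).
  by apply: integral_ge0.
rewrite ge0_integralZl//; last 2 first.
- exact: (measurableT_comp mG (measurable_affine1 _ _)).
- by rewrite lee_fin invr_ge0 exprn_ge0// ltW.
rewrite (@ge0_integral_affine1 a (b 0%R ord0) (fun s =>
    \int[lebesgue_rV R n]_v F (consrV (s, v))))//.
by rewrite muleA -EFinM -invfM -exprSr ge0_integral_consrV.
Qed.

Lemma integrable_affine n (a : R) (b : 'rV[R]_n) (F : 'rV[R]_n -> \bar R) :
  (0 < a)%R -> (lebesgue_rV R n).-integrable setT F ->
  (lebesgue_rV R n).-integrable setT (fun x => F (a *: x + b)%R).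
Proof.
move=> a0 /integrableP[mF Foo]; apply/integrableP; split.
  exact: (measurableT_comp mF (measurable_affine a b)).
rewrite (@ge0_integral_affine _ a b (abse \o F))//; last 2 first.
- exact: measurableT_comp.
- by move=> x; exact: abse_ge0.
by rewrite lte_mul_pinfty// lee_fin invr_ge0 exprn_ge0// ltW.
Qed.

Lemma integral_affine n (a : R) (b : 'rV[R]_n) (F : 'rV[R]_n -> \bar R) :
  (0 < a)%R -> (lebesgue_rV R n).-integrable setT F ->
  \int[lebesgue_rV R n]_x F (a *: x + b)%R =
  (a ^- n)%:E * \int[lebesgue_rV R n]_x F x.
Proof.
move=> a0 iF; have mF := measurable_int _ iF.
rewrite integralE [in RHS]integralE muleBr//; last first.
  by rewrite fin_num_adde_defl// fin_numN; exact: integrable_neg_fin_num.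
rewrite -(ge0_integral_affine b a0 (measurable_funepos mF))//.
rewrite -(ge0_integral_affine b a0 (measurable_funeneg mF))//.
by congr (_ - _); apply: eq_integral => x _; rewrite ?funeposE ?funenegE.
Qed.

End affine_change_of_variables.

(** * Dominated products, dot product and tensor products *)

Section real_preliminaries.
Variable R : realType.

Lemma measurable_cos : measurable_fun setT (@cos R : measurableTypeR R -> measurableTypeR R).
Proof. by apply: continuous_measurable_fun; exact: continuous_cos. Qed.

Lemma cos_lipschitz (a b : R) : `|cos a - cos b| <= `|a - b|.
Proof.
wlog ab : a b / b <= a.
  by move=> H; have [/H//|/ltW/H] := leP b a; rewrite distrC [leRHS]distrC.
have [|c _ ->] := @MVT_segment R cos (fun x => - sin x) b a ab.
  by apply: continuous_subspaceT => x; exact: continuous_cos.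
by rewrite normrM normrN ler_piMl// ler_norml sin_le1 sin_geN1.
Qed.

Lemma is_derive_cos_affine (k b c h : R) :
  is_derive h 1 (fun h => k * cos (h * b + c)) (- (k * b * sin (h * b + c))).
Proof.
have h1 : is_derive h 1 (fun h : R => h * b + c) b.
  by apply: is_derive_eq; rewrite scaler0 add0r addr0 [LHS]mulr1.
have h2 := @is_derive1_comp R cos (fun h : R => h * b + c) h _ _ (is_derive_cos _) h1.
have h3 := @is_deriveZ R R R _ k h 1 _ h2.
by apply: is_derive_eq; rewrite [LHS]/GRing.scale/=; ring.
Qed.

Lemma sin_max (s : R) : `|sin s| <= 1.
Proof. by rewrite ler_norml sin_le1 sin_geN1. Qed.

Lemma integrableM_bounded d (T : measurableType d) (nu : {measure set T -> \bar R})
    (f g : T -> R) (K : R) :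
  nu.-integrable setT (EFin \o f) ->
  measurable_fun setT (g : _ -> measurableTypeR R) -> (forall x, `|g x| <= K) ->
  nu.-integrable setT (EFin \o (fun x => f x * g x)).
Proof.
move=> iF mg gK.
have mf : measurable_fun setT (f : _ -> measurableTypeR R).
  by apply/measurable_EFinP; exact: measurable_int iF.
have iKf := integrableZl measurableT K iF.
apply: (le_integrable measurableT _ _ iKf).
  by apply/measurable_EFinP; exact: measurable_funM.
move=> x _ /=; rewrite lee_fin !normrM mulrC ler_wpM2r//.
exact: le_trans (gK x) (ler_norm K).
Qed.

Lemma integrable_prodM d1 d2 (T1 : measurableType d1) (T2 : measurableType d2)
    (m1 : {sigma_finite_measure set T1 -> \bar R})
    (m2 : {sigma_finite_measure set T2 -> \bar R}) (f : T1 -> R) (g : T2 -> R) :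
  m1.-integrable setT (EFin \o f) -> m2.-integrable setT (EFin \o g) ->
  (m1 \x m2)%E.-integrable setT (fun p => (f p.1 * g p.2)%:E).
Proof.
move=> iF iG.
have /measurable_EFinP mf := measurable_int _ iF.
have /measurable_EFinP mg := measurable_int _ iG.
have mfg : measurable_fun setT (fun p : T1 * T2 => (f p.1 * g p.2)%:E).
  apply/measurable_EFinP; apply: measurable_funM.
    exact: (measurableT_comp mf).
  exact: (measurableT_comp mg).
have fing := integrable_fin_num measurableT (integrable_norm iG).
set I2 := integral _ _ _ in fing.
have I20 : 0 <= fine I2.
  by apply: fine_ge0; apply: integral_ge0 => x _ /=; rewrite lee_fin.
apply/(integrable12ltyP _ _ mfg).
under eq_integral => x _.
  under eq_integral do rewrite /= normrM EFinM.
  rewrite ge0_integralZl//; last by apply/measurable_EFinP; exact: measurableT_comp.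
  rewrite -/I2 -(fineK fing) muleC.
  over.
rewrite ge0_integralZl//; last by apply/measurable_EFinP; exact: measurableT_comp.
rewrite lte_mul_pinfty ?lee_fin//.
by have /integrableP[_] := iF.
Qed.

End real_preliminaries.

Section dot_product.
Variables (R : realType) (n : nat).
Implicit Types x y z : 'rV[R]_n.

Lemma dotrVC x y : dotrV x y = dotrV y x.
Proof. by apply: eq_bigr => i _; rewrite mulrC. Qed.

Lemma dotrVDr x y z : dotrV x (y + z) = dotrV x y + dotrV x z.
Proof. by rewrite -big_split; apply: eq_bigr => i _; rewrite mxE mulrDr. Qed.

Lemma dotrVDl x y z : dotrV (x + y) z = dotrV x z + dotrV y z.
Proof. by rewrite dotrVC dotrVDr !(dotrVC z). Qed.

Lemma dotrVZr a x y : dotrV x (a *: y) = a * dotrV x y.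
Proof. by rewrite mulr_sumr; apply: eq_bigr => i _; rewrite mxE mulrCA. Qed.

Lemma dotrVNr x y : dotrV x (- y) = - dotrV x y.
Proof. by rewrite -scaleN1r dotrVZr mulN1r. Qed.

Lemma dotrVZl a x y : dotrV (a *: x) y = a * dotrV x y.
Proof. by rewrite dotrVC dotrVZr dotrVC. Qed.

Lemma dotrV_delta x i : dotrV x (delta_mx 0 i) = x 0 i.
Proof.
rewrite /dotrV (bigD1 i)//= !mxE !eqxx mulr1 big1 ?addr0// => j ji.
by rewrite mxE (negbTE ji) andbF mulr0.
Qed.

Lemma le_dotrV x y : `|dotrV x y| <= `|y| * \sum_(i < n) `|x 0 i|.
Proof.
rewrite mulr_sumr (le_trans (ler_norm_sum _ _ _))//.
apply: ler_sum => i _; rewrite normrM mulrC ler_wpM2r//.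
rewrite [leRHS]/Num.norm /= mx_normrE; apply/bigmax_geP; right => /=.
by exists (ord0, i).
Qed.

Lemma measurable_dotrV d (T : measurableType d) (f g : T -> 'rV[R]_n) :
  measurable_fun setT f -> measurable_fun setT g ->
  measurable_fun setT (fun t => dotrV (f t) (g t) : measurableTypeR R).
Proof.
move=> mf mg; apply: measurable_sum => i; apply: measurable_funM.
- exact: (measurableT_comp (measurable_coord i) mf).
- exact: (measurableT_comp (measurable_coord i) mg).
Qed.

End dot_product.

Section tensor_products.
Variables (R : realType).
Local Open Scope ereal_scope.
Local Notation lambda := (@lebesgue_measure R).

Definition tensor (k : R -> R) n (x : 'rV[R]_n) : R := (\prod_(i < n) k (x 0 i))%R.

Lemma tensor_consrV (k : R -> R) n s (v : 'rV[R]_n) :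
  tensor k (consrV (s, v)) = (k s * tensor k v)%R.
Proof.
rewrite /tensor big_ord_recl mxE unlift_none; congr (_ * _)%R.
by apply: eq_bigr => i _; rewrite mxE liftK.
Qed.

Lemma tensor_ge0 (k : R -> R) n (x : 'rV[R]_n) :
  (forall s, 0 <= k s)%R -> (0 <= tensor k x)%R.
Proof. by move=> k0; apply: prodr_ge0. Qed.

Lemma measurable_tensor (k : R -> R) n :
  measurable_fun setT (k : measurableTypeR R -> measurableTypeR R) ->
  measurable_fun setT (@tensor k n : _ -> measurableTypeR R).
Proof.
move=> mk; apply: measurable_prod => i _.
exact: (measurableT_comp mk (measurable_coord i)).
Qed.

Lemma ge0_integral_tensor (k : R -> R) (c : R) n :
  measurable_fun setT (k : measurableTypeR R -> measurableTypeR R) ->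
  (forall s, 0 <= k s)%R -> \int[lambda]_s (k s)%:E = c%:E ->
  \int[lebesgue_rV R n]_x (tensor k x)%:E = (c ^+ n)%:E.
Proof.
move=> mk k0 kc; elim: n => [|n IHn].
  rewrite expr0 (eq_integral (fun=> 1%:E)).
    by rewrite integral_cst// mul1e /= diracE mem_set.
  by move=> x _; rewrite /tensor big_ord0.
rewrite ge0_integral_consrV; last 2 first.
- by apply/measurable_EFinP; exact: measurable_tensor.
- by move=> x; rewrite lee_fin tensor_ge0.
transitivity (\int[lambda]_s ((c ^+ n)%:E * (k s)%:E)).
  apply: eq_integral => s _; under eq_integral do rewrite tensor_consrV EFinM.
  rewrite ge0_integralZl ?IHn ?lee_fin// 1?muleC//.
  - by apply/measurable_EFinP; exact: measurable_tensor.
  - by move=> x _; rewrite lee_fin tensor_ge0.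
rewrite ge0_integralZl ?kc ?lee_fin//.
- by rewrite -EFinM exprSr.
- exact/measurable_EFinP.
- by move=> s _; rewrite lee_fin.
- by rewrite exprn_ge0// -lee_fin -kc integral_ge0// => s _; rewrite lee_fin.
Qed.

Lemma integrable_tensor (k : R -> R) (c : R) n :
  measurable_fun setT (k : measurableTypeR R -> measurableTypeR R) ->
  (forall s, 0 <= k s)%R -> \int[lambda]_s (k s)%:E = c%:E ->
  (lebesgue_rV R n).-integrable setT (EFin \o @tensor k n).
Proof.
move=> mk k0 kc; apply/integrableP; split.
  by apply/measurable_EFinP; exact: measurable_tensor.
under eq_integral do rewrite /= ger0_norm ?tensor_ge0//.
by rewrite (ge0_integral_tensor _ mk k0 kc) ltry.
Qed.

End tensor_products.

(** * Rapidly decreasing functions *)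

Section half_line_integrals.
Variable R : realType.
Local Open Scope ereal_scope.
Local Notation lambda := (@lebesgue_measure R).

(** Folding the line at 0 turns the integrals of even and odd functions into
half-line integrals, where the fundamental theorem of calculus applies. *)
Lemma ge0_integral_fold (f : R -> R) :
  measurable_fun setT (f : measurableTypeR R -> measurableTypeR R) ->
  (forall x, 0 <= f x)%R ->
  \int[lambda]_x (f x)%:E = \int[lambda]_(x in `[0%R, +oo[) (f x + f (- x))%:E.
Proof.
move=> mf f0.
have mfN : measurable_fun setT ((fun x => f (- x)%R) : measurableTypeR R -> measurableTypeR R).
  by apply: (measurableT_comp mf).
have mEf D : measurable_fun D (EFin \o f).
  by apply/measurable_EFinP; exact: measurable_funTS.
rewrite -{1}setC0 -(set_itvoc0 0%R) setCitv/= ge0_integral_setU//=; first last.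
- rewrite disj_set2E; apply/eqP; rewrite -subset0 => x []/= /[!in_itv]/=.
  by rewrite leNgt andbT => /negP.
- by move=> x _; rewrite lee_fin.
- exact: mEf.
rewrite integral_itv_obnd_cbnd//.
under [RHS]eq_integral do rewrite EFinD.
rewrite ge0_integralD//=; last 4 first.
- by move=> x _; rewrite lee_fin.
- exact: mEf.
- by move=> x _; rewrite lee_fin.
- by apply/measurable_EFinP; apply: measurable_funTS.
rewrite addeC; congr (_ + _).
rewrite (@ge0_integration_by_substitution0 R (fun x => (f (- x))%:E)); last 2 first.
- exact/measurable_EFinP.
- by move=> r; rewrite lee_fin.
by apply: eq_integral => x _; rewrite opprK.
Qed.

Lemma integral_cauchy : \int[lambda]_s ((oneDsqr s)^-1)%:E = pi%:E.
Proof.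
have cc := @continuous_oneDsqrV R.
have mc : measurable_fun setT ((fun s => (oneDsqr s)^-1)%R : measurableTypeR R -> measurableTypeR R).
  exact: continuous_measurable_fun.
rewrite ge0_integral_fold//.
transitivity (\int[lambda]_(x in `[0%R, +oo[) (2%:E * ((oneDsqr x)^-1)%:E)).
  by apply: eq_integral => x _; rewrite /oneDsqr sqrrN -EFinM mulrDl mul1r.
rewrite ge0_integralZl//; last by apply/measurable_EFinP; exact: measurable_funTS.
by rewrite integral0y_oneDsqr -EFinM mulrCA divff// mulr1.
Qed.

End half_line_integrals.

Section rapid_decay.
Variables (R : realType) (n : nat).
Implicit Types psi : 'rV[R]_n -> R.

(** The zeroth-order part of the Schwartz condition. It is stable under
multiplication by affine coordinates, which is all that differentiating a
cosine integral produces. *)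
Definition rapid psi := measurable_fun setT (psi : _ -> measurableTypeR R) /\
  forall N, exists C, forall y, (1 + enorm y) ^+ N * `|psi y| <= C.

Lemma schwartz_rapid psi : schwartz psi -> rapid psi.
Proof.
move=> [sm dec]; split.
  by apply: continuous_measurable_rV; have [] := sm [::].
move=> N; have [C0 /= hC0] := dec [::] 0%N; have [C /= hC] := dec [::] N.
exists (2 ^+ N * (C0 + C)) => y.
have e0 := enorm_ge0 y.
have pN : (1 + enorm y) ^+ N <= 2 ^+ N * (1 + enorm y ^+ N).
  have [e1|e1] := leP (enorm y) 1.
    apply: (@le_trans _ _ (2 ^+ N)).
      by rewrite lerXn2r ?nnegrE ?addr_ge0//; lra.
    by rewrite ler_peMr ?exprn_ge0// lerDl exprn_ge0.
  apply: (@le_trans _ _ ((2 * enorm y) ^+ N)).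
    by rewrite lerXn2r ?nnegrE ?addr_ge0 ?mulr_ge0//; lra.
  by rewrite exprMn ler_wpM2l ?exprn_ge0// lerDr.
apply: le_trans (ler_wpM2r (normr_ge0 _) pN) _.
rewrite -mulrA ler_wpM2l ?exprn_ge0// mulrDl mul1r lerD//.
by have := hC0 y; rewrite expr0 mul1r.
Qed.

Lemma rapidZ psi (c : R) : rapid psi -> rapid (fun y => c * psi y).
Proof.
move=> [mpsi dec]; split; first by apply: measurable_funM.
move=> N; have [C hC] := dec N; exists (`|c| * C) => y.
by rewrite normrM mulrCA ler_wpM2l.
Qed.

Lemma rapid_affineM psi (a : R) (x : 'rV[R]_n) i : rapid psi ->
  rapid (fun y => psi y * (a *: y + x) 0 i).
Proof.
move=> [mpsi dec]; split.
  apply: measurable_funM => //.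
  exact: (measurableT_comp (measurable_coord i) (measurable_affine a x)).
move=> N; have [C hC] := dec N.+1; exists ((`|a| + `|x 0 i|) * C) => y.
have e0 := enorm_ge0 y.
have bi : `|(a *: y + x) 0 i| <= (`|a| + `|x 0 i|) * (1 + enorm y).
  rewrite !mxE (le_trans (ler_normD _ _))// normrM.
  have yi := le_coord_enorm y i.
  have : `|a| * `|y 0 i| <= `|a| * enorm y by rewrite ler_wpM2l.
  have : 0 <= `|a| by []. have : 0 <= `|x 0 i| * enorm y by rewrite mulr_ge0.
  by rewrite mulrDl !mulrDr !mulr1; lra.
rewrite normrM mulrA (le_trans (ler_wpM2l _ bi)) ?mulr_ge0 ?exprn_ge0 ?addr_ge0//.
have -> : (1 + enorm y) ^+ N * `|psi y| * ((`|a| + `|x 0 i|) * (1 + enorm y)) =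
  (`|a| + `|x 0 i|) * ((1 + enorm y) ^+ N.+1 * `|psi y|) by rewrite exprS; ring.
by rewrite ler_wpM2l ?addr_ge0.
Qed.

(** The product of the 1 + y_i^2 is at most (1 + |y|)^(2n), so a rapidly
decreasing function is dominated by an integrable tensor product. *)
Lemma rapid_integrable psi : rapid psi ->
  (lebesgue_rV R n).-integrable setT (EFin \o psi).
Proof.
move=> [mpsi dec]; have [C hC] := dec (2 * n)%N.
have mc : measurable_fun setT
    ((fun s => (oneDsqr s)^-1) : measurableTypeR R -> measurableTypeR R).
  by apply: continuous_measurable_fun; exact: continuous_oneDsqrV.
apply: (@le_integrable _ _ _ _ _ measurableT _
  (fun x => C%:E * (tensor (fun s => (oneDsqr s)^-1) x)%:E)%E); last first.
- apply: integrableZl => //; apply: integrable_tensor (integral_cauchy R) => //.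
- move=> y _ /=; rewrite lee_fin [leRHS]ger0_norm; last first.
    rewrite mulr_ge0 ?tensor_ge0//.
    by apply: le_trans (hC y); rewrite mulr_ge0 ?exprn_ge0 ?addr_ge0 ?enorm_ge0.
  rewrite /tensor prodfV ler_pdivlMr; last first.
    by apply: prodr_gt0 => i _; rewrite (lt_le_trans ltr01)// oneDsqr_ge1.
  apply: le_trans (hC y); rewrite mulrC ler_wpM2r//.
  rewrite exprM (_ : (_ ^+ 2) ^+ n = \prod_(i < n) (1 + enorm y) ^+ 2); last first.
    by rewrite prodr_const card_ord.
  apply: ler_prod => i _.
  have := le_coord_enorm y i; have e0 := enorm_ge0 y.
  rewrite (le_trans ler01 (oneDsqr_ge1 _))/= /oneDsqr sqrrD expr1n mul1r => yi.
  rewrite -addrA lerD2l ler_wpDl ?mulrn_wge0//.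
  by rewrite -real_normK ?num_real// ler_pXn2r ?nnegrE.
- exact/measurable_EFinP.
Qed.

End rapid_decay.

(** * Smoothness of cosine integrals *)

Section cosine_integral.
Variables (R : realType) (n : nat) (a : R) (x : 'rV[R]_n).
Implicit Types (psi : 'rV[R]_n -> R) (xi : 'rV[R]_n) (delta : R).
Local Notation mu := (lebesgue_rV R n).

(** The affine map [a *: y + x] and the phase [delta] are what makes this family
closed both under partial derivatives and under multiplication by a plane wave. *)
Definition cosint psi delta xi : R :=
  \int[mu]_y (psi y * cos (dotrV (a *: y + x) xi + delta)).

Lemma measurable_cosarg xi delta :
  measurable_fun setT (fun y : 'rV[R]_n =>
    cos (dotrV (a *: y + x) xi + delta) : measurableTypeR R).
Proof.
apply: (measurableT_comp (@measurable_cos R)); apply: measurable_funD => //.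
by apply: measurable_dotrV => //; exact: measurable_affine.
Qed.

Lemma integrable_cosint psi delta xi : rapid psi ->
  mu.-integrable setT
    (EFin \o (fun y => psi y * cos (dotrV (a *: y + x) xi + delta))).
Proof.
move=> rpsi; exact: (integrableM_bounded (rapid_integrable rpsi)
  (measurable_cosarg xi delta) (fun y => cos_max _)).
Qed.

(** The cosine is 1-Lipschitz, so the integral is Lipschitz with constant the
first moment of [psi]. *)
Lemma cosint_continuous psi delta : rapid psi -> continuous (cosint psi delta).
Proof.
move=> rpsi xi.
pose w (y : 'rV[R]_n) : R := \sum_(i < n) `|psi y * (a *: y + x) 0 i|.
have iw : mu.-integrable setT (EFin \o w).
  rewrite (_ : _ \o _ = fun y => (\sum_(i < n) `|psi y * (a *: y + x) 0 i|%:E)%E).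
    apply: integrable_sum => // i _; apply: integrable_norm.
    by apply: rapid_integrable; exact: rapid_affineM.
  by apply/funext => y /=; rewrite /w sumEFin.
have w0 y : 0 <= w y by exact: sumr_ge0.
have lip eta : `|cosint psi delta xi - cosint psi delta eta| <=
    `|xi - eta| * \int[mu]_y w y.
  rewrite /cosint -RintegralB//; [|exact: integrable_cosint|exact: integrable_cosint].
  have iB : mu.-integrable setT (EFin \o (fun y =>
      psi y * cos (dotrV (a *: y + x) xi + delta) -
      psi y * cos (dotrV (a *: y + x) eta + delta))).
    exact: (integrableB measurableT (integrable_cosint delta xi rpsi)
      (integrable_cosint delta eta rpsi)).
  apply: le_trans (le_normr_Rintegral measurableT iB) _.
  rewrite -RintegralZl//; apply: le_Rintegral => //.
  - exact: integrable_norm.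
  - exact: (integrableZl measurableT `|xi - eta| iw).
  move=> y _; rewrite -mulrBr normrM.
  apply: le_trans (ler_wpM2l (normr_ge0 _) (cos_lipschitz _ _)) _.
  rewrite opprD addrACA subrr addr0.
  have -> : dotrV (a *: y + x) xi - dotrV (a *: y + x) eta =
      dotrV (a *: y + x) (xi - eta).
    by rewrite dotrVDr dotrVNr.
  apply: le_trans (ler_wpM2l (normr_ge0 _) (le_dotrV _ _)) _.
  rewrite mulrCA ler_wpM2l// /w mulr_sumr ler_sum// => i _.
  by rewrite normrM.
have Fxi : Filter (nbhs (xi : 'rV[R]_n)) := nbhs_filter _.
apply/cvgrPdist_le => e e0.
have W0 : 0 <= \int[mu]_y w y by exact: Rintegral_ge0.
near=> eta.
apply: le_trans (lip eta) _.
apply: (@le_trans _ _ (e / (1 + \int[mu]_y w y) * \int[mu]_y w y)).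
  rewrite ler_wpM2r//; near: eta; apply: cvgr_dist_le => //.
  by rewrite divr_gt0// ltr_pwDl.
by rewrite mulrAC ler_pdivrMr ?ltr_pwDl// ler_pM2l// lerDr.
Unshelve. all: by end_near. Qed.

(** Differentiating under the integral sign multiplies the weight by a
coordinate and advances the phase by a quarter turn. *)
Lemma cosint_derive psi delta (i : 'I_n) xi : rapid psi ->
  h^-1 *: (cosint psi delta (h *: delta_mx 0 i + xi) - cosint psi delta xi)
    @[h --> 0^'] -->
  cosint (fun y => psi y * (a *: y + x) 0 i) (delta + pi / 2) xi.
Proof.
move=> rpsi.
pose f (h : R) (y : 'rV[R]_n) : R :=
  psi y * cos (h * (a *: y + x) 0 i + (dotrV (a *: y + x) xi + delta)).
have fE h y : f h y =
    psi y * cos (dotrV (a *: y + x) (h *: delta_mx 0 i + xi) + delta).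
  by rewrite /f dotrVDr dotrVZr dotrV_delta addrA.
have df (y : 'rV[R]_n) (h : R) : is_derive h 1 (f ^~ y) _ :=
  is_derive_cos_affine _ _ _ h.
have d1f h y : partial1of2 f h y = - (psi y * (a *: y + x) 0 i *
    sin (h * (a *: y + x) 0 i + (dotrV (a *: y + x) xi + delta))).
  by rewrite partial1of2E; have /@derive_val -> := df y h.
pose G y := `|psi y * (a *: y + x) 0 i|.
have iG : mu.-integrable setT (EFin \o G).
  by apply: integrable_norm; apply: rapid_integrable; exact: rapid_affineM.
have inf h : mu.-integrable setT (EFin \o f h).
  rewrite (_ : f h = fun y =>
    psi y * cos (dotrV (a *: y + x) (h *: delta_mx 0 i + xi) + delta)).
    exact: integrable_cosint.
  exact/funext.
have I0 : `]-1, 1[%classic (0 : R) by rewrite /= in_itv/= ltrN10 ltr01.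
have := @cvg_differentiation_under_integral R _ _ mu f setT measurableT 0 (-1) 1
  I0 (fun h _ => inf h) (fun h y _ _ => @ex_derive _ _ _ _ _ _ _ (df y h)) G
  (fun y => normr_ge0 _) iG.
rewrite [X in _ --> X](_ : _ =
    cosint (fun y => psi y * (a *: y + x) 0 i) (delta + pi / 2) xi); last first.
  apply: eq_Rintegral => y _; rewrite d1f mul0r add0r addrA cosDpihalf.
  by rewrite mulrN.
rewrite [X in X @ _](_ : _ = (fun h : R => h^-1 *:
    (cosint psi delta (h *: delta_mx 0 i + xi) - cosint psi delta xi))); last first.
  apply/funext => h; rewrite addr0; congr (_ *: (_ - _)).
    by apply: eq_Rintegral => y _; rewrite fE.
  by apply: eq_Rintegral => y _; rewrite fE scale0r add0r.
apply => h y _ _; rewrite d1f normrN normrM ler_piMr//.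
by rewrite ler_norml sin_le1 sin_geN1.
Qed.

Lemma partials_cosint (s : seq 'I_n) psi delta : rapid psi ->
  exists psi' delta', rapid psi' /\ partials s (cosint psi delta) = cosint psi' delta'.
Proof.
move=> rpsi; elim: s => [|i s [psi' [delta' [rpsi' /= ->]]]].
  by exists psi, delta.
exists (fun y => psi' y * (a *: y + x) 0 i), (delta' + pi / 2).
split; first exact: rapid_affineM.
apply/funext => xi; have := @cosint_derive psi' delta' i xi rpsi'.
by move/cvg_lim; apply.
Qed.

Lemma cosint_smooth psi delta : rapid psi -> smooth (cosint psi delta).
Proof.
move=> rpsi s; have [psi' [delta' [rpsi' ->]]] := partials_cosint s delta rpsi.
split; first exact: cosint_continuous.
move=> i xi; apply/cvg_ex; exists
  (cosint (fun y => psi' y * (a *: y + x) 0 i) (delta' + pi / 2) xi).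
exact: (@cosint_derive psi' delta' i xi rpsi').
Qed.

End cosine_integral.

(** * The Abel kernel and its transform *)

Section abel_kernel.
Variable R : realType.
Local Notation lambda := (@lebesgue_measure R).

Definition abel (s : R) : R := expR (- `|s|).

Lemma abel_ge0 s : 0 <= abel s. Proof. exact: expR_ge0. Qed.

Lemma measurable_abel : measurable_fun setT (abel : measurableTypeR R -> measurableTypeR R).
Proof.
apply: continuous_measurable_fun => s; apply: continuous_comp; last exact: continuous_expR.
by apply: continuousN; exact: norm_continuous.
Qed.

(** An explicit primitive of exp(-s) (1 + cos(z s)). The summand 1 keeps the
integrand nonnegative, as the improper fundamental theorem requires. *)
Lemma is_derive_abel_cos (z s : R) : is_derive s 1
  (fun s => expR (- s) * ((z * sin (z * s) - cos (z * s)) / oneDsqr z - 1))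
  (expR (- s) * (1 + cos (z * s))).
Proof.
have z1 : oneDsqr z != 0 by rewrite gt_eqF// (lt_le_trans ltr01)// oneDsqr_ge1.
have lin : is_derive s 1 (fun s : R => z * s) z.
  by apply: is_derive_eq; rewrite [LHS]mulr1.
have dsin := @is_derive1_comp R sin (fun s : R => z * s) s _ _ (is_derive_sin _) lin.
have dcos := @is_derive1_comp R cos (fun s : R => z * s) s _ _ (is_derive_cos _) lin.
have neg : is_derive s 1 (fun s : R => - s) (- 1) by apply: is_derive_eq.
have dexp := @is_derive1_comp R expR (fun s : R => - s) s _ _ (is_derive_expR _) neg.
have dtrig : is_derive s 1
    (fun s => (z * sin (z * s) - cos (z * s)) / oneDsqr z - 1)
    ((z * (cos (z * s) * z) - (- sin (z * s) * z)) / oneDsqr z).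
  have dB := is_deriveB (is_deriveZ z dsin) dcos.
  have dC := is_deriveZ (oneDsqr z)^-1 dB.
  have dD := is_deriveB dC (is_derive_cst (1 : R) s 1).
  rewrite [X in is_derive _ _ X](_ : _ = ((oneDsqr z)^-1 \*:
     (z \*: (sin \o (fun s : R => z * s)) - (cos \o (fun s : R => z * s)))) - cst 1).
    by apply: (is_derive_eq dD); rewrite subr0 [LHS]mulrC.
  by apply/funext => u /=; congr (_ - _); rewrite mulrC.
have dM := is_deriveM dexp dtrig.
apply: (is_derive_eq dM); rewrite /GRing.scale/=.
by rewrite /oneDsqr in z1 *; field.
Qed.

Lemma integral_abel_half (z : R) :
  (\int[lambda]_(s in `[0%R, +oo[) (expR (- s) * (1 + cos (z * s)))%:E =
   (1 + (oneDsqr z)^-1)%:E)%E.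
Proof.
pose F (s : R) := expR (- s) * ((z * sin (z * s) - cos (z * s)) / oneDsqr z - 1).
have z1 : 0 < oneDsqr z by rewrite (lt_le_trans ltr01)// oneDsqr_ge1.
have cF : continuous F.
  by move=> s; apply: differentiable_continuous; apply/derivable1_diffP;
    apply: ex_derive; exact: is_derive_abel_cos.
have cf : continuous (fun s : R => expR (- s) * (1 + cos (z * s))).
  move=> s; apply: cvgM.
    by apply: (@continuous_comp _ _ _ -%R (@expR R));
      [exact: oppr_continuous|exact: continuous_expR].
  apply: cvgD; first exact: cvg_cst.
  apply: (@continuous_comp _ _ _ ( *%R z) (@cos R)); last exact: continuous_cos.
  exact: mulrl_continuous.
rewrite (@ge0_continuous_FTC2y R _ F 0 0).
- rewrite /F oppr0 expR0 mul1r mulr0 sin0 cos0 mulr0 sub0r -EFinB; congr EFin.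
  by rewrite mulN1r; lra.
- move=> s _; rewrite mulr_ge0 ?expR_ge0// -lerBlDl sub0r; exact: cos_geN1.
- exact: continuous_subspaceT.
- pose K := (`|z| + 1) / oneDsqr z + 1.
  have K0 : expR (- s) * K @[s --> +oo] --> (0 : R).
    by rewrite -(mul0r K); apply: cvgM; [exact: cvgr_expR|exact: cvg_cst].
  suff sq : \forall s \near +oo, - (expR (- s) * K) <= F s <= expR (- s) * K.
    by apply: (squeeze_cvgr sq) => //; rewrite -oppr0; exact: cvgN.
  apply: nearW => s; rewrite -ler_norml normrM ger0_norm ?expR_ge0// ler_wpM2l ?expR_ge0//.
  rewrite (le_trans (ler_normB _ _))// normr1 lerD2r normrM normfV.
  rewrite (ger0_norm (ltW z1)) ler_wpM2r ?invr_ge0 ?(ltW z1)//.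
  rewrite (le_trans (ler_normB _ _))// lerD ?cos_max// normrM ler_piMr//.
  by rewrite ler_norml sin_le1 sin_geN1.
- by move=> s _; apply: ex_derive; exact: is_derive_abel_cos.
- by apply: cvg_at_right_filter; exact: cF.
- by move=> s _; rewrite derive1E; apply: derive_val; exact: is_derive_abel_cos.
Qed.

Lemma ge0_integral_abel_fold (g h : R -> R) :
  measurable_fun setT (g : measurableTypeR R -> measurableTypeR R) ->
  (forall s, 0 <= g s) -> (forall s, g s + g (- s) = h s) ->
  (\int[lambda]_s (abel s * g s)%:E =
   \int[lambda]_(s in `[0%R, +oo[) (expR (- s) * h s)%:E)%E.
Proof.
move=> mg g0 gh; rewrite ge0_integral_fold.
- apply: eq_integral => s; rewrite inE/= in_itv/= andbT => s0.
  by rewrite /abel normrN ger0_norm// -mulrDr gh.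
- by apply: measurable_funM => //; exact: measurable_abel.
- by move=> s; rewrite mulr_ge0 ?abel_ge0.
Qed.

Lemma integral_abel : (\int[lambda]_s (abel s)%:E = 2%:E)%E.
Proof.
transitivity (\int[lambda]_s (abel s * cst 1 s)%:E)%E.
  by apply: eq_integral => s _; rewrite mulr1.
rewrite (@ge0_integral_abel_fold _ (fun s => 1 + cos (0 * s)))//.
- by rewrite integral_abel_half /oneDsqr expr0n addr0 invr1.
- by move=> s; rewrite mul0r cos0.
Qed.

Lemma integrable_abel : lambda.-integrable setT (EFin \o abel).
Proof.
apply/integrableP; split; first by apply/measurable_EFinP; exact: measurable_abel.
under eq_integral do rewrite /= ger0_norm ?abel_ge0//.
by rewrite integral_abel ltry.
Qed.

Lemma integrable_abelM (g : R -> R) :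
  measurable_fun setT (g : measurableTypeR R -> measurableTypeR R) ->
  (forall s, `|g s| <= 1) -> lambda.-integrable setT (fun s => (abel s * g s)%:E).
Proof.
by move=> mg g1; exact: (integrableM_bounded integrable_abel mg g1).
Qed.

(* Removes the 1 again, using that the kernel has integral 2. *)
Let integral_abel1D (g : R -> R) (c : R) :
  measurable_fun setT (g : measurableTypeR R -> measurableTypeR R) ->
  (forall s, `|g s| <= 1) ->
  (\int[lambda]_s (abel s * (1 + g s))%:E = (2 + c)%:E)%E ->
  (\int[lambda]_s (abel s * g s)%:E = c%:E)%E.
Proof.
move=> mg g1 H.
have iag := integrable_abelM mg g1.
have : (\int[lambda]_s (abel s * (1 + g s))%:E =
    \int[lambda]_s (abel s)%:E + \int[lambda]_s (abel s * g s)%:E)%E.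
  rewrite -integralD_EFin//; last exact: integrable_abel.
  by apply: eq_integral => s _; rewrite mulrDr mulr1.
have fin := integrable_fin_num measurableT iag.
by rewrite H integral_abel -(fineK fin) -EFinD => -[] /addrI ->.
Qed.

Lemma measurable_trig (f : R -> R) (z : R) : continuous f ->
  measurable_fun setT ((fun s => f (z * s)) : measurableTypeR R -> measurableTypeR R).
Proof.
move=> cf; apply: continuous_measurable_fun => s.
by apply: (@continuous_comp _ _ _ ( *%R z) f); [exact: mulrl_continuous|exact: cf].
Qed.

Lemma integral_abel_cos z :
  (\int[lambda]_s (abel s * cos (z * s))%:E = (2 / oneDsqr z)%:E)%E.
Proof.
have mc := measurable_trig z (@continuous_cos R).
apply: integral_abel1D => //; first by move=> s; exact: cos_max.
rewrite (@ge0_integral_abel_fold _ (fun s => 2 * (1 + cos (z * s)))).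
- transitivity (\int[lambda]_(s in `[0%R, +oo[) (2%:E * (expR (- s) * (1 + cos (z * s)))%:E))%E.
    by apply: eq_integral => s _; rewrite -EFinM mulrCA.
  rewrite ge0_integralZl//.
  + by rewrite integral_abel_half -EFinM mulrDr mulr1.
  + apply/measurable_EFinP; apply: measurable_funTS; apply: measurable_funM.
      by apply: (measurableT_comp (@measurable_expR R)).
    by apply: measurable_funD.
- by apply: measurable_funD.
- by move=> s; rewrite -lerBlDl sub0r cos_geN1.
- by move=> s; rewrite mulrN cosN; ring.
Qed.

Lemma integral_abel_sin z : (\int[lambda]_s (abel s * sin (z * s))%:E = 0)%E.
Proof.
have ms := measurable_trig z (@continuous_sin R).
apply: integral_abel1D => //.
  by move=> s; rewrite ler_norml sin_le1 sin_geN1.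
rewrite (@ge0_integral_abel_fold _ (fun s => 1 + cos (0 * s))).
- by rewrite integral_abel_half /oneDsqr expr0n !addr0 invr1.
- by apply: measurable_funD.
- by move=> s; rewrite -lerBlDl sub0r sin_geN1.
- by move=> s; rewrite mulrN sinN mul0r cos0; ring.
Qed.

End abel_kernel.
Arguments abel {R} s.
Section abel_tensor.
Variable R : realType.
Local Notation lambda := (@lebesgue_measure R).

Definition poisson (z : R) : R := 2 / oneDsqr z.

Lemma poisson_ge0 z : 0 <= poisson z.
Proof. by rewrite divr_ge0// (le_trans ler01 (oneDsqr_ge1 z)). Qed.

Lemma measurable_poisson :
  measurable_fun setT (poisson : measurableTypeR R -> measurableTypeR R).
Proof.
apply: measurable_funM => //.
by apply: continuous_measurable_fun; exact: continuous_oneDsqrV.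
Qed.

Lemma integral_poisson : (\int[lambda]_s (poisson s)%:E = (2 * pi)%:E)%E.
Proof.
under eq_integral do rewrite EFinM.
rewrite ge0_integralZl ?integral_cauchy//.
apply/measurable_EFinP.
by apply: continuous_measurable_fun; exact: continuous_oneDsqrV.
Qed.

Lemma abel_tensorE n (x : 'rV[R]_n) : tensor abel x = expR (- \sum_(i < n) `|x 0 i|).
Proof. by rewrite -sumrN expR_sum. Qed.

Lemma integrable_abel_tensor n :
  (lebesgue_rV R n).-integrable setT (EFin \o @tensor R abel n).
Proof.
exact: (integrable_tensor n (@measurable_abel R) (@abel_ge0 R) (integral_abel R)).
Qed.

Lemma integrable_abel_tensorM n (g : 'rV[R]_n -> R) :
  measurable_fun setT (g : _ -> measurableTypeR R) -> (forall x, `|g x| <= 1) ->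
  (lebesgue_rV R n).-integrable setT (EFin \o (fun x => tensor abel x * g x)).
Proof.
by move=> mg g1; exact: (integrableM_bounded (integrable_abel_tensor n) mg g1).
Qed.

Lemma measurable_trig_dotrV n (f : R -> R) (z : 'rV[R]_n) : continuous f ->
  measurable_fun setT ((fun x => f (dotrV z x)) : 'rV[R]_n -> measurableTypeR R).
Proof.
move=> cf.
apply: (@measurableT_comp _ _ _ _ _ _ (f : measurableTypeR R -> measurableTypeR R)).
  exact: continuous_measurable_fun.
exact: measurable_dotrV.
Qed.

Lemma integrable_abel_cos n (z : 'rV[R]_n) :
  (lebesgue_rV R n).-integrable setT
    (EFin \o (fun x => tensor abel x * cos (dotrV z x))).
Proof.
apply: integrable_abel_tensorM; first exact: (measurable_trig_dotrV z (@continuous_cos R)).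
by move=> x; exact: cos_max.
Qed.

Lemma integrable_abel_sin n (z : 'rV[R]_n) :
  (lebesgue_rV R n).-integrable setT
    (EFin \o (fun x => tensor abel x * sin (dotrV z x))).
Proof.
apply: integrable_abel_tensorM; first exact: (measurable_trig_dotrV z (@continuous_sin R)).
by move=> x; exact: sin_max.
Qed.

Lemma dotrV_consrV n (z : 'rV[R]_n.+1) s v :
  dotrV z (consrV (s, v)) = z 0 ord0 * s + dotrV (\row_j z 0 (lift ord0 j)) v.
Proof.
rewrite /dotrV big_ord_recl !mxE unlift_none/=; congr (_ + _).
by apply: eq_bigr => i _; rewrite !mxE liftK.
Qed.

Lemma tensor_rowS (k : R -> R) n (z : 'rV[R]_n.+1) :
  tensor k z = k (z 0 ord0) * tensor k (\row_j z 0 (lift ord0 j)).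
Proof.
rewrite /tensor big_ord_recl; congr (_ * _).
by apply: eq_bigr => i _; rewrite mxE.
Qed.

(** Cosine and sine have to be treated together: the addition formulas mix them
when the first coordinate is split off. The sine integral vanishes by parity. *)
Lemma integral_abel_tensor_trig n (z : 'rV[R]_n) :
  (\int[lebesgue_rV R n]_x (tensor abel x * cos (dotrV z x))%:E =
    (tensor poisson z)%:E)%E /\
  (\int[lebesgue_rV R n]_x (tensor abel x * sin (dotrV z x))%:E = 0)%E.
Proof.
elim: n z => [|n IHn] z.
  split.
    rewrite (eq_integral (fun=> 1%:E)).
      by rewrite integral_cst// mul1e /= diracE mem_set// /tensor big_ord0.
    by move=> x _; rewrite /tensor /dotrV !big_ord0 cos0 mulr1.
  by apply: integral0_eq => x _; rewrite /tensor /dotrV !big_ord0 sin0 mulr0.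
rewrite !integral_consrV; [|exact: integrable_abel_sin|exact: integrable_abel_cos].
set z0 := z 0 ord0; set z' := \row_j z 0 (lift ord0 j).
have [IHc IHs] := IHn z'.
have split2 (c1 c2 : R) :
    (\int[lebesgue_rV R n]_v (c1 * (tensor abel v * cos (dotrV z' v)) +
      c2 * (tensor abel v * sin (dotrV z' v)))%:E = (c1 * tensor poisson z')%:E)%E.
  have ic := integrable_abel_cos z'; have isn := integrable_abel_sin z'.
  under eq_integral do rewrite EFinD !EFinM.
  rewrite integralD//; [|exact: (integrableZl measurableT c1 ic)
    |exact: (integrableZl measurableT c2 isn)].
  rewrite !integralZl//.
  by rewrite IHc IHs mule0 adde0 -EFinM.
split.
- transitivity (\int[lambda]_s ((abel s * cos (z0 * s))%:E * (tensor poisson z')%:E))%E.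
    apply: eq_integral => s _.
    rewrite -EFinM -(split2 _ (- (abel s * sin (z0 * s)))).
    apply: eq_integral => v _; congr EFin.
    by rewrite tensor_consrV dotrV_consrV cosD; ring.
  rewrite integralZr//.
    by rewrite integral_abel_cos -EFinM tensor_rowS.
  exact: (integrable_abelM (measurable_trig z0 (@continuous_cos R)) (fun s => cos_max _)).
- transitivity (\int[lambda]_s ((abel s * sin (z0 * s))%:E * (tensor poisson z')%:E))%E.
    apply: eq_integral => s _.
    rewrite -EFinM -(split2 _ (abel s * cos (z0 * s))).
    apply: eq_integral => v _; congr EFin.
    by rewrite tensor_consrV dotrV_consrV sinD; ring.
  rewrite integralZr//.
    by rewrite integral_abel_sin mul0e.
  exact: (integrable_abelM (measurable_trig z0 (@continuous_sin R)) (fun s => sin_max _)).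
Qed.

End abel_tensor.
Arguments poisson {R} z.
(** * Fourier inversion *)

Section fourier_inversion.
Variables (R : realType) (n : nat).
Local Notation mu := (lebesgue_rV R n).

Variable phi : 'rV[R]_n -> R.
Hypotheses (rphi : rapid phi) (cphi : continuous phi).

Definition cos_transform (xi : 'rV[R]_n) : R := \int[mu]_x (phi x * cos (dotrV x xi)).
Definition sin_transform (xi : 'rV[R]_n) : R := \int[mu]_x (phi x * sin (dotrV x xi)).

Lemma measurable_dotrVl (f : R -> R) (xi : 'rV[R]_n) : continuous f ->
  measurable_fun setT ((fun x => f (dotrV x xi)) : 'rV[R]_n -> measurableTypeR R).
Proof.
move=> cf; under eq_fun do rewrite dotrVC.
exact: measurable_trig_dotrV.
Qed.

Lemma integrable_cos_transform xi :
  mu.-integrable setT (EFin \o (fun x => phi x * cos (dotrV x xi))).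
Proof.
apply: (integrableM_bounded (rapid_integrable rphi)
  (measurable_dotrVl xi (@continuous_cos R))) => x; exact: cos_max.
Qed.

Lemma integrable_sin_transform xi :
  mu.-integrable setT (EFin \o (fun x => phi x * sin (dotrV x xi))).
Proof.
apply: (integrableM_bounded (rapid_integrable rphi)
  (measurable_dotrVl xi (@continuous_sin R))) => x; exact: sin_max.
Qed.

Hypothesis sin_transform0 : forall xi, sin_transform xi = 0.

(** Where reality of the transform enters: with no sine part, translating [phi]
only multiplies the cosine transform by a cosine. *)
Lemma cos_transform_shift y xi :
  (\int[mu]_x (phi x * cos (dotrV (x - y) xi))%:E =
   (cos_transform xi * cos (dotrV y xi))%:E)%E.
Proof.
have ic := integrable_cos_transform xi; have isn := integrable_sin_transform xi.
transitivity (\int[mu]_x ((cos (dotrV y xi) * (phi x * cos (dotrV x xi)))%:E +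
    (sin (dotrV y xi) * (phi x * sin (dotrV x xi)))%:E))%E.
  apply: eq_integral => x _; rewrite -EFinD; congr EFin.
  by rewrite dotrVDl (dotrVC (- y)) dotrVNr (dotrVC xi) cosB; ring.
rewrite integralD//; [|exact: (integrableZl measurableT _ ic)
  |exact: (integrableZl measurableT _ isn)].
under eq_integral do rewrite EFinM.
under [X in (_ + X)%E]eq_integral do rewrite EFinM.
rewrite !integralZl//.
have fine_eq (f : 'rV[R]_n -> R) : mu.-integrable setT (EFin \o f) ->
    (\int[mu]_x (f x)%:E = (\int[mu]_x f x)%:E)%E.
  by move=> iF; rewrite /Rintegral fineK//; exact: integrable_fin_num.
rewrite (fine_eq _ ic) (fine_eq _ isn) -/(cos_transform _) -/(sin_transform _).
by rewrite sin_transform0 mule0 adde0 -EFinM mulrC.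
Qed.

Lemma integral_abel_dilated (e : R) (w : 'rV[R]_n) : 0 < e ->
  (\int[mu]_xi (tensor abel (e *: xi) * cos (dotrV w xi))%:E =
   (e ^- n * tensor poisson (e^-1 *: w))%:E)%E.
Proof.
move=> e0; rewrite EFinM -(integral_abel_tensor_trig (e^-1 *: w)).1.
rewrite -(integral_affine 0 e0 (integrable_abel_cos (e^-1 *: w))).
apply: eq_integral => xi _ /=; rewrite addr0 dotrVZl dotrVZr mulrA mulVf ?mul1r//.
by rewrite gt_eqF.
Qed.

(** Abel means of the inversion integral. Fubini moves the damping onto the
cosine, whose integral is a dilated product of Poisson kernels, and the change
of variables x = e z + y undoes the dilation. *)
Lemma abel_mean (e : R) (y : 'rV[R]_n) : 0 < e ->
  (\int[mu]_xi (cos_transform xi * cos (dotrV y xi) * tensor abel (e *: xi))%:E =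
   \int[mu]_z (phi (e *: z + y) * tensor poisson z)%:E)%E.
Proof.
move=> e0.
pose g (p : 'rV[R]_n * 'rV[R]_n) : \bar R :=
  (phi p.1 * cos (dotrV (p.1 - y) p.2) * tensor abel (e *: p.2))%:E.
have mtab : measurable_fun setT (fun xi : 'rV[R]_n =>
    tensor abel (e *: xi) : measurableTypeR R).
  rewrite (_ : (fun xi => _) = @tensor R abel n \o (fun xi : 'rV[R]_n => e *: xi + 0)).
    exact: (measurableT_comp (@measurable_tensor R abel n (@measurable_abel R))
      (measurable_affine e 0)).
  by apply/funext => xi /=; rewrite addr0.
have itab : mu.-integrable setT (fun xi : 'rV[R]_n => (tensor abel (e *: xi))%:E).
  have := integrable_affine 0 e0 (integrable_abel_tensor R n).
  by apply: eq_integrable => // xi _ /=; rewrite addr0.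
have msub : measurable_fun setT (fun x : 'rV[R]_n => x - y).
  have := @measurable_affine R n 1 (- y); under eq_fun do rewrite scale1r.
  exact.
have mg : measurable_fun setT g.
  apply/measurable_EFinP; apply: measurable_funM; last first.
    by apply: (measurableT_comp mtab).
  apply: measurable_funM; first exact: (measurableT_comp rphi.1).
  apply: (measurableT_comp (@measurable_cos R)); apply: measurable_dotrV => //.
  exact: (measurableT_comp msub).
have ig : (mu \x mu)%E.-integrable setT g.
  have iprod := integrable_prodM (rapid_integrable rphi) itab.
  have mcos : measurable_fun setT (fun p : 'rV[R]_n * 'rV[R]_n =>
      cos (dotrV (p.1 - y) p.2) : measurableTypeR R).
    apply: (measurableT_comp (@measurable_cos R)); apply: measurable_dotrV => //.
    exact: (measurableT_comp msub).
  have := integrableM_bounded iprod mcos (fun p => cos_max _).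
  by apply: eq_integrable => // p _; rewrite /g /= mulrAC.
transitivity (\int[mu]_xi \int[mu]_x g (x, xi))%E.
  apply: eq_integral => xi _; rewrite /g/= EFinM -cos_transform_shift.
  rewrite -integralZr//.
  apply: (integrableM_bounded (rapid_integrable rphi) _ (fun x => cos_max _)).
  apply: (measurableT_comp (@measurable_cos R)); exact: measurable_dotrV.
rewrite -(Fubini ig) /g /=.
pose h x := phi x * (e ^- n * tensor poisson (e^-1 *: (x - y))).
transitivity (\int[mu]_x (h x)%:E)%E.
  apply: eq_integral => x _.
  rewrite /h EFinM -integral_abel_dilated// -integralZl//.
    by apply: eq_integral => xi _; rewrite -EFinM mulrA mulrAC -mulrA.
  apply: (integrableM_bounded itab _ (fun x => cos_max _)).
  exact: (measurable_trig_dotrV (x - y) (@continuous_cos R)).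
have en0 : e ^+ n != 0 by rewrite expf_neq0// gt_eqF.
have ei0 : 0 < e^-1 by rewrite invr_gt0.
have hE z : h (e *: z + y) = e ^- n * (phi (e *: z + y) * tensor poisson z).
  by rewrite /h addrK scalerA mulVf ?gt_eqF// scale1r mulrCA.
have ipois : mu.-integrable setT (EFin \o @tensor R poisson n).
  exact: (integrable_tensor n (@measurable_poisson R) (@poisson_ge0 R) (integral_poisson R)).
have [C hC] := rphi.2 0%N.
have phiC x : `|phi x| <= C by rewrite (le_trans _ (hC x))// expr0 mul1r.
have ih : mu.-integrable setT (EFin \o h).
  have i1 := integrable_affine (- (e^-1 *: y)) ei0 ipois.
  have i2 := integrableM_bounded i1 rphi.1 phiC.
  have i3 := integrableZl measurableT (e ^- n) i2.
  apply: eq_integrable i3 => // x _ /=; rewrite /h -EFinM; congr EFin.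
  by rewrite scalerBr [RHS]mulrCA [in RHS](mulrC (phi x)).
have := integral_affine y e0 ih; under eq_integral do rewrite /= hE EFinM.
rewrite integralZl//; last first.
  have i2 := integrableM_bounded ipois (measurableT_comp rphi.1 (measurable_affine e y))
    (fun z => phiC _).
  by apply: eq_integrable i2 => // x _ /=; rewrite mulrC.
move=> /(congr1 (fun u => (e ^+ n)%:E * u)%E).
by rewrite !muleA -!EFinM divff// !mul1e.
Qed.

Hypothesis icos : mu.-integrable setT (EFin \o cos_transform).

(** Both sides of [abel_mean] converge as e tends to 0: the left one dominated by
the integrable transform, the right one by the bounded [phi] times the Poisson
kernel, whose total mass is (2 pi)^n. *)
Lemma cos_inversion y :
  \int[mu]_xi (cos_transform xi * cos (dotrV y xi)) = (2 * pi) ^+ n * phi y.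
Proof.
pose e (m : nat) : R := m.+1%:R^-1.
have e0 m : 0 < e m by rewrite invr_gt0.
have ecvg : e @ \oo --> (0 : R) by exact: cvg_harmonic.
have mcos := measurable_trig_dotrV y (@continuous_cos R).
have icc := integrableM_bounded icos mcos (fun x => cos_max _).
have ipois : mu.-integrable setT (EFin \o @tensor R poisson n).
  exact: (integrable_tensor n (@measurable_poisson R) (@poisson_ge0 R) (integral_poisson R)).
have [C hC] := rphi.2 0%N.
have phiC x : `|phi x| <= C by rewrite (le_trans _ (hC x))// expr0 mul1r.
have tab1 (x : 'rV[R]_n) : `|tensor abel x| <= 1.
  rewrite abel_tensorE ger0_norm ?expR_ge0// -expR0 ler_expR oppr_le0.
  exact: sumr_ge0.
have mtab m : measurable_fun setT (fun xi : 'rV[R]_n =>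
    tensor abel (e m *: xi) : measurableTypeR R).
  have := measurableT_comp (@measurable_tensor R abel n (@measurable_abel R))
    (measurable_affine (e m) 0).
  by apply: eq_measurable_fun => xi _ /=; rewrite addr0.
pose L m := (\int[mu]_xi (cos_transform xi * cos (dotrV y xi) *
  tensor abel (e m *: xi))%:E)%E.
have cvgL : L @ \oo --> (\int[mu]_xi (cos_transform xi * cos (dotrV y xi))%:E)%E.
  apply: (@dominated_cvg _ _ _ mu setT measurableT
    (fun m xi => (cos_transform xi * cos (dotrV y xi) * tensor abel (e m *: xi))%:E)
    _ (fun xi => `|cos_transform xi * cos (dotrV y xi)|%:E)).
  - move=> m; apply/measurable_EFinP; apply: measurable_funM; last exact: mtab.
    by apply/measurable_EFinP; exact: measurable_int icc.
  - move=> xi _; apply: cvg_EFin; first exact: nearW.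
    rewrite -[X in _ --> X]mulr1; apply: cvgM; first exact: cvg_cst.
    rewrite (_ : (fun m => _) = (fun m => expR (- (e m * \sum_(i < n) `|xi 0 i|)))); last first.
      apply/funext => m; rewrite abel_tensorE mulr_sumr; congr (expR (- _)).
      by apply: eq_bigr => i _; rewrite mxE normrM (ger0_norm (ltW (e0 m))).
    set S := \sum_(i < n) `|xi 0 i|.
    suff : expR (- (e m * S)) @[m --> \oo] --> expR (- (0 * S)).
      by rewrite mul0r oppr0 expR0.
    apply: (@cvg_comp _ _ _ _ (@expR R)); last exact: continuous_expR.
    by apply: cvgN; apply: cvgM => //; exact: cvg_cst.
  - by [].
  - exact: integrable_norm.
  - by move=> m xi _; rewrite lee_fin normrM ler_piMr.
have cvgR : L @ \oo --> (\int[mu]_z (phi y * tensor poisson z)%:E)%E.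
  rewrite (_ : L = fun m => \int[mu]_z (phi (e m *: z + y) * tensor poisson z)%:E)%E; last first.
    by apply/funext => m; rewrite /L abel_mean.
  apply: (@dominated_cvg _ _ _ mu setT measurableT
    (fun m z => (phi (e m *: z + y) * tensor poisson z)%:E)
    _ (fun z => (C * tensor poisson z)%:E)).
  - move=> m; apply/measurable_EFinP; apply: measurable_funM.
      exact: (measurableT_comp rphi.1 (measurable_affine _ _)).
    by apply: measurable_tensor; exact: measurable_poisson.
  - move=> z _; apply: cvg_EFin; first exact: nearW.
    apply: cvgM; last exact: cvg_cst.
    suff : (fun m => phi (e m *: z + y)) @ \oo --> phi (0 *: z + y).
      by rewrite scale0r add0r.
    have ez : (fun m => e m *: z + y) @ \oo --> 0 *: z + y.
      by apply: cvgD; [apply: cvgZr_tmp|exact: cvg_cst].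
    by apply: (cvg_comp _ _ ez); exact: cphi.
  - by [].
  - exact: (integrableZl measurableT C ipois).
  - move=> m z _; have t0 := tensor_ge0 z (@poisson_ge0 R).
    by rewrite lee_fin normrM (ger0_norm t0) ler_wpM2r.
have := cvg_unique (@ereal_hausdorff R) cvgL cvgR.
rewrite /Rintegral => ->.
under eq_integral do rewrite EFinM.
rewrite integralZl// (ge0_integral_tensor n (@measurable_poisson R) (@poisson_ge0 R)
  (integral_poisson R)).
by rewrite -EFinM/= mulrC.
Qed.

End fourier_inversion.

(** * Littlewood-Paley blocks of a nonnegative spectrum *)

Section real_and_imaginary_parts.
Variables (R : realType) (n : nat).
Local Notation mu := (lebesgue_rV R n).
Implicit Types f : 'rV[R]_n -> R.

Lemma Re_realM (r : R) (z : R[i]) : complex.Re (r%:C * z)%C = r * complex.Re z.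
Proof. by case: z => a b /=; rewrite mul0r subr0. Qed.

Lemma Im_realM (r : R) (z : R[i]) : complex.Im (r%:C * z)%C = r * complex.Im z.
Proof. by case: z => a b /=; rewrite mul0r addr0. Qed.

Lemma Re_fourier f xi :
  complex.Re (fourier f xi) = fourier_cst R n * cos_transform f xi.
Proof.
rewrite /fourier Re_realM /cintegral /=; congr (_ * _).
by apply: eq_Rintegral => x _; rewrite mul0r subr0.
Qed.

Lemma Im_fourier f xi : mu.-integrable setT (EFin \o f) ->
  complex.Im (fourier f xi) = - (fourier_cst R n * sin_transform f xi).
Proof.
move=> iF; rewrite /fourier Im_realM /cintegral /= -mulrN; congr (_ * _).
have isn := integrableM_bounded iF (measurable_dotrVl xi (@continuous_sin R))
  (fun x => sin_max _).
rewrite /sin_transform -mulN1r -RintegralZl//.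
by apply: eq_Rintegral => x _; rewrite mul0r addr0 mulrN mulN1r.
Qed.

End real_and_imaginary_parts.

Section littlewood_paley_block.
Variables (R : realType) (n : nat) (phi : 'rV[R]_n -> R).
Hypothesis hphi : littlewood_paley phi.
Local Notation mu := (lebesgue_rV R n).
Local Notation c0 := (fourier_cst R n).

Let rphi : rapid phi.
Proof. by case: hphi => + _ _ _; exact: schwartz_rapid. Qed.

Let cphi : continuous phi.
Proof. by case: hphi => -[+ _] _ _ _ => /(_ [::])[]. Qed.

Let c0_gt0 : 0 < c0. Proof. exact: fourier_cst_gt0. Qed.

(** The transform of [phi], which the Littlewood-Paley conditions force to be
real; see [fourier_window]. *)
Definition window (xi : 'rV[R]_n) : R := c0 * cos_transform phi xi.

Lemma fourier_window xi : fourier phi xi = (window xi)%:C%C /\ sin_transform phi xi = 0.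
Proof.
have [_ /(_ xi) + _ _] := hphi; rewrite !lecE => /andP[/andP[/eqP im0 _] _].
have : complex.Im (fourier phi xi) = 0 by [].
rewrite Im_fourier; last exact: rapid_integrable.
move=> /eqP; rewrite oppr_eq0 mulf_eq0 gt_eqF//= => /eqP s0; split=> //.
apply/eqP; rewrite eq_complex Re_fourier Im_fourier; last exact: rapid_integrable.
by rewrite s0 mulr0 oppr0 !eqxx.
Qed.

Lemma window_itv xi : 0 <= window xi <= 1.
Proof.
have [_ /(_ xi) + _ _] := hphi; rewrite (fourier_window xi).1 !lecE /=.
by rewrite !eqxx.
Qed.

Lemma window_support xi : window xi != 0 -> 4^-1 <= enorm xi <= 1.
Proof.
have [_ _ /(_ xi) + _] := hphi; rewrite (fourier_window xi).1 => H w0; apply: H.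
by rewrite eq_complex/= eqxx andbT.
Qed.

Lemma window_neq0 xi : xi != 0 -> exists k : int, window ((2 : R) ^ k *: xi) != 0.
Proof.
move=> xi0; have [_ _ _ /(_ _ xi0)] := hphi; apply: contraPP => /forallNP H.
rewrite esum1; first by move=> /eqP; rewrite eq_sym onee_eq0.
move=> j _; rewrite (fourier_window _).1 /=.
by have /negP := H j; rewrite negbK => /eqP ->.
Qed.

(** Modulating the dilated window costs no more than changing the affine map and
the phase of the cosine integral, because the sine part vanishes. *)
Lemma window_phase (a : R) (x xi : 'rV[R]_n) (delta : R) :
  cosint a x (fun y => c0 * phi y) delta xi = window (a *: xi) * cos (dotrV x xi + delta).
Proof.
have ic := integrable_cos_transform rphi (a *: xi).
have isn := integrable_sin_transform rphi (a *: xi).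
set b := dotrV x xi + delta.
transitivity (\int[mu]_y (c0 * cos b * (phi y * cos (dotrV y (a *: xi))) -
    c0 * sin b * (phi y * sin (dotrV y (a *: xi))))).
  apply: eq_Rintegral => y _.
  by rewrite dotrVDl dotrVZl -dotrVZr -addrA -/b cosD; ring.
rewrite RintegralB//; [|exact: (integrableZl measurableT _ ic)
  |exact: (integrableZl measurableT _ isn)].
rewrite !RintegralZl// -/(cos_transform phi _) -/(sin_transform phi _).
by rewrite (fourier_window _).2 mulr0 subr0 /window mulrAC.
Qed.

Lemma window_continuous : continuous window.
Proof.
rewrite (_ : window = cosint 1 0 (fun y => c0 * phi y) 0).
  by apply: cosint_continuous; exact: rapidZ.
apply/funext => xi; rewrite window_phase scale1r addr0.
by rewrite (_ : dotrV 0 xi = 0) ?cos0 ?mulr1// -(scale0r 0) dotrVZl mul0r.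
Qed.

Lemma integrable_window : mu.-integrable setT (EFin \o window).
Proof.
have mw : measurable_fun setT (window : _ -> measurableTypeR R).
  exact: continuous_measurable_rV window_continuous.
have i1 : mu.-integrable setT (EFin \o \1_(cube (0 : 'rV[R]_n) 1)).
  have mc := @measurable_cube R n 0 1.
  apply/integrableP; split; first exact/measurable_EFinP.
  under eq_integral do rewrite /= ger0_norm//.
  rewrite integral_indic// setIT.
  suff : (lebesgue_rV R n (cube 0%R 1%R) < +oo)%E by [].
  by rewrite lebesgue_cube// ltry.
apply: (le_integrable measurableT _ _ i1); first exact/measurable_EFinP.
move=> xi _ /=; rewrite lee_fin indicE.
have /andP[w0 w1] := window_itv xi; rewrite ger0_norm// ger0_norm//.
have [->|/window_support/andP[_ xi1]] := eqVneq (window xi) 0 => //.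
rewrite mem_set// => i; rewrite !mxE subr0.
exact: le_trans (le_coord_enorm xi i) xi1.
Qed.

Lemma integrable_cos_transform_lp : mu.-integrable setT (EFin \o cos_transform phi).
Proof.
have := integrableZl measurableT c0^-1 integrable_window.
apply: eq_integrable => // xi _ /=; rewrite -EFinM /window mulrA mulVf ?mul1r//.
by rewrite gt_eqF.
Qed.

(** The phases 0 and - pi / 2 give the real and imaginary parts of the modulated
window, which together carry the translation of a block to the point [x]. *)
Definition theta (a : R) (x : 'rV[R]_n) (delta : R) (xi : 'rV[R]_n) : R :=
  window (a *: xi) * cos (dotrV x xi + delta).

Lemma theta_test_function (a : R) x delta : 0 < a -> test_function (theta a x delta).
Proof.
move=> a0; split.
  rewrite (_ : theta a x delta = cosint a x (fun y => c0 * phi y) delta).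
    by apply: cosint_smooth; exact: rapidZ.
  by apply/funext => xi; rewrite window_phase.
exists a^-1 => xi xia; rewrite /theta (_ : window _ = 0) ?mul0r//.
apply/eqP; apply: contraLR xia => /window_support/andP[_].
by rewrite enormZ gtr0_norm// mulrC -ler_pdivlMr// div1r -leNgt.
Qed.

Lemma integrable_window_dilated (a : R) : 0 < a ->
  mu.-integrable setT (EFin \o (fun xi => window (a *: xi))).
Proof.
move=> a0; have := integrable_affine 0 a0 integrable_window.
by apply: eq_integrable => // xi _ /=; rewrite addr0.
Qed.

Lemma measurable_cos_phase (x : 'rV[R]_n) (delta : R) :
  measurable_fun setT (fun xi => cos (dotrV x xi + delta) : measurableTypeR R).
Proof.
apply: (measurableT_comp (@measurable_cos R)); apply: measurable_funD => //.
exact: measurable_dotrV.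
Qed.

Lemma integrable_theta (a : R) x delta : 0 < a ->
  mu.-integrable setT (EFin \o theta a x delta).
Proof.
move=> a0; exact: (integrableM_bounded (integrable_window_dilated a0)
  (measurable_cos_phase x delta) (fun xi => cos_max _)).
Qed.

(** Inversion for [phi] at [2 ^ j *: z], rescaled in frequency; the Jacobian
cancels the normalization of [dilate]. *)
Lemma dilate_inversion (j : int) (z : 'rV[R]_n) :
  (2 * pi) ^+ n * c0 * dilate phi j z =
  \int[mu]_xi (window ((2 : R) ^ (- j) *: xi) * cos (dotrV z xi)).
Proof.
set a := (2 : R) ^ (- j); have a0 : 0 < a by exact: exprz_gt0.
have av : a^-1 = (2 : R) ^ j by rewrite /a invr_expz opprK.
have inv := cos_inversion rphi cphi (fun xi => (fourier_window xi).2)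
  integrable_cos_transform_lp (a^-1 *: z).
have icc := integrableM_bounded integrable_cos_transform_lp
  (measurable_trig_dotrV (a^-1 *: z) (@continuous_cos R)) (fun x => cos_max _).
have scaled := integral_affine 0 a0 icc.
have icd := integrable_affine 0 a0 icc.
transitivity (c0 * \int[mu]_xi (cos_transform phi (a *: xi + 0) *
    cos (dotrV (a^-1 *: z) (a *: xi + 0)))); last first.
  rewrite -RintegralZl//; apply: eq_Rintegral => xi _.
  rewrite addr0 dotrVZl dotrVZr mulrA mulrA mulVf ?gt_eqF// mul1r.
  by rewrite /window.
rewrite [X in _ = c0 * X]/Rintegral scaled fineM//; last exact: integrable_fin_num.
move: inv; rewrite /Rintegral /= => ->.
rewrite /dilate av (_ : (2 : R) ^ (n%:Z * j) = a ^- n); first by ring.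
by rewrite -exprVn av exprnP exprz_exp mulrC.
Qed.

Lemma dilate_fourier_theta (j : int) (x y : 'rV[R]_n) :
  let a := (2 : R) ^ (- j) in
  (2 * pi) ^+ n * c0 ^+ 2 * dilate phi j (x - y) =
  complex.Re (fourier (theta a x 0) y) - complex.Im (fourier (theta a x (- (pi / 2))) y).
Proof.
move=> a; have a0 : 0 < a by exact: exprz_gt0.
rewrite Re_fourier Im_fourier; last exact: integrable_theta.
rewrite opprK -mulrDr expr2 mulrA mulrAC dilate_inversion mulrC -/a; congr (_ * _).
have ic := integrableM_bounded (integrable_theta x 0 a0)
  (measurable_dotrVl y (@continuous_cos R)) (fun xi => cos_max _).
have isn := integrableM_bounded (integrable_theta x (- (pi / 2)) a0)
  (measurable_dotrVl y (@continuous_sin R)) (fun xi => sin_max _).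
rewrite /cos_transform /sin_transform -RintegralD//.
apply: eq_Rintegral => xi _.
rewrite /theta addr0 cosBpihalf dotrVDl (dotrVC (- y)) dotrVNr (dotrVC xi) cosB; ring.
Qed.

(** The kernel is a combination of transforms of test functions, so the weak
Fourier transform of [u] evaluates the block at every single [x], not just
almost everywhere. The imaginary part contributes nothing as [w] is real. *)
Lemma conv_dilate (u : 'rV[R]_n -> R) (w : 'rV[R]_n -> \bar R) (j : int) (x : 'rV[R]_n) :
  is_fourier u w ->
  (((2 * pi) ^+ n * c0 ^+ 2)%:E * Defs.conv (dilate phi j) u x =
   \int[mu]_xi (w xi * (theta ((2 : R) ^ (- j)) x 0 xi)%:E))%E.
Proof.
move=> [_ hw]; set a := (2 : R) ^ (- j); have a0 : 0 < a by exact: exprz_gt0.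
have [[ic _] iw ec] := hw _ (theta_test_function x 0 a0).
have [[_ isn] _ es] := hw _ (theta_test_function x (- (pi / 2)) a0).
pose f y := complex.Re ((u y)%:C%C * fourier (theta a x 0) y).
pose g y := complex.Im ((u y)%:C%C * fourier (theta a x (- (pi / 2))) y).
have fw : \int[mu]_y f y = fine (\int[mu]_xi (w xi * (theta a x 0 xi)%:E))%E.
  exact: (congr1 (@complex.Re R) ec).
have g0 : \int[mu]_y g y = 0 by exact: (congr1 (@complex.Im R) es).
set K := (2 * pi) ^+ n * c0 ^+ 2.
have K0 : 0 < K by rewrite mulr_gt0// exprn_gt0// mulr_gt0// pi_gt0.
have ifg := integrableB measurableT ic isn.
have kernelE y : dilate phi j (x - y) * u y = K^-1 * (f y - g y).
  rewrite /f /g Re_realM Im_realM -mulrBr -dilate_fourier_theta -/K mulrCA mulrA.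
  by rewrite mulrA divfK ?gt_eqF// mulrC.
have -> : Defs.conv (dilate phi j) u x = (K^-1 * \int[mu]_y (f y - g y))%:E.
  rewrite -RintegralZl// /Rintegral fineK /Defs.conv.
    by apply: eq_integral => y _; rewrite kernelE.
  exact: (integrable_fin_num measurableT (integrableZl measurableT K^-1 ifg)).
rewrite RintegralB// fw g0 subr0 -EFinM mulrA divff ?gt_eqF// mul1r fineK//.
exact: integrable_fin_num.
Qed.

End littlewood_paley_block.

Section sup_norm.
Local Open Scope ereal_scope.

Lemma Lnorm_pinfty_ge d (T : measurableType d) (R : realType)
    (mu : {measure set T -> \bar R}) (f : T -> \bar R) (A : set T) (b : \bar R) :
  measurable A -> 0 < mu A -> (forall x, A x -> b <= `|f x|) ->
  b <= Lnorm mu +oo f.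
Proof.
move=> mA A0 bf; rewrite unlock /=.
rewrite (lt_le_trans A0); last by apply: le_measure; rewrite ?inE.
rewrite leNgt; apply/negP => supb.
have [N [mN N0 subN]] := ess_sup_ge mu (abse \o f).
move: A0; rewrite (@subset_measure0 _ _ _ mu A N)// ?ltxx// => x Ax.
apply: subN => /= fx; have := le_lt_trans (le_trans (bf x Ax) fx) supb.
by rewrite ltxx.
Qed.

End sup_norm.

Section block_lower_bound.
Variables (R : realType) (n : nat) (n0 : (0 < n)%N) (phi : 'rV[R]_n -> R).
Hypothesis hphi : littlewood_paley phi.
Local Notation mu := (lebesgue_rV R n).
Local Notation c0 := (fourier_cst R n).

Lemma le_dotrV_enorm (x y : 'rV[R]_n) : `|dotrV x y| <= enorm y * \sum_(i < n) `|x 0 i|.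
Proof.
rewrite mulr_sumr (le_trans (ler_norm_sum _ _ _))//.
apply: ler_sum => i _; rewrite normrM mulrC ler_wpM2r//.
exact: le_coord_enorm.
Qed.

Lemma cos_ge_half (t : R) : `|t| <= 2^-1 -> 2^-1 <= cos t.
Proof.
move=> t1; have := cos_lipschitz t 0; rewrite cos0 subr0 ler_distl => /andP[+ _].
by lra.
Qed.

(** For |x_i| at most [a / (2 n)] and |xi| at most [a^-1], with [a = 2 ^ (- j)],
the phase x.xi is at most 1/2 in absolute value and its cosine at least 1/2, so
the integrand of [conv_dilate] is nonnegative. Such [x] fill a set of positive
measure, which the essential supremum cannot ignore. *)
Lemma block_lower_bound (u : 'rV[R]_n -> R) (w : 'rV[R]_n -> \bar R) (j : int)
    (y : 'rV[R]_n) (A m r : R) :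
  is_fourier u w -> (forall xi, xi != 0 -> (0 <= w xi)%E) -> 0 <= A -> 0 <= m -> 0 <= r ->
  (forall xi, cube y r xi -> xi != 0 -> (A%:E <= w xi)%E) ->
  (forall xi, cube y r xi -> m <= window phi ((2 : R) ^ (- j) *: xi)) ->
  ((A * (m / 2) * (2 * r) ^+ n)%:E <=
   ((2 * pi) ^+ n * c0 ^+ 2)%:E * Lnorm mu +oo (Defs.conv (dilate phi j) u))%E.
Proof.
move=> uw w_ge0 A0 m0 r0 Aw mwin; set a := (2 : R) ^ (- j).
have a0 : 0 < a by exact: exprz_gt0.
set K := (2 * pi) ^+ n * c0 ^+ 2.
have K0 : 0 < K.
  by rewrite mulr_gt0// exprn_gt0 ?fourier_cst_gt0// mulr_gt0// pi_gt0.
pose rho := a / (2 * n%:R).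
have nR0 : 0 < n%:R :> R by rewrite ltr0n.
have rho0 : 0 < rho by rewrite divr_gt0// mulr_gt0.
have cos_half x xi : cube 0 rho x -> window phi (a *: xi) != 0 ->
    2^-1 <= cos (dotrV x xi + 0).
  move=> xrho /(window_support hphi)/andP[_]; rewrite enormZ gtr0_norm// addr0 => axi.
  apply: cos_ge_half; apply: le_trans (le_dotrV_enorm _ _) _.
  have : \sum_(i < n) `|x 0 i| <= n%:R * rho.
    rewrite mulr_natl -[n in _ *+ n]card_ord -sumr_const; apply: ler_sum => i _.
    by have := xrho i; rewrite mxE subr0.
  move=> /(ler_wpM2l (enorm_ge0 xi)) /le_trans; apply.
  have -> : enorm xi * (n%:R * rho) = a * enorm xi / 2.
    by rewrite /rho; field; rewrite gt_eqF.
  by lra.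
have lower x : cube 0 rho x ->
    ((A * (m / 2) * (2 * r) ^+ n)%:E <= K%:E * Defs.conv (dilate phi j) u x)%E.
  move=> xrho; rewrite (conv_dilate hphi _ _ uw) -/a.
  have m0n := lebesgue_set1_rV (0 : 'rV[R]_n) n0.
  rewrite EFinM -(lebesgue_cube y r0).
  apply: (cst_le_integral (measurable_set1_rV _) m0n) => //.
  - exact: measurable_cube.
  - by rewrite mulr_ge0// divr_ge0.
  - move=> xi _ /eqP xi0; have [wi0|wi0] := eqVneq (window phi (a *: xi)) 0.
      by rewrite /theta wi0 mul0r mule0.
    rewrite mule_ge0 ?w_ge0// lee_fin mulr_ge0//.
      by have /andP[] := window_itv hphi (a *: xi).
    by rewrite (le_trans _ (cos_half _ _ xrho wi0)).
  - move=> xi xiQ /eqP xi0; rewrite EFinM lee_pmul ?lee_fin ?divr_ge0 ?Aw//.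
    have [wi0|wi0] := eqVneq (window phi (a *: xi)) 0.
      have := mwin _ xiQ; rewrite -/a wi0 /theta wi0 mul0r; lra.
    by rewrite ler_pM ?mwin ?cos_half// invr_ge0.
set B := A * (m / 2) * (2 * r) ^+ n in lower *.
have KV : B = K * (K^-1 * B) by rewrite mulrA divff ?mul1r// gt_eqF.
rewrite [in leLHS]KV EFinM lee_wpmul2l ?lee_fin ?(ltW K0)//.
apply: (@Lnorm_pinfty_ge _ _ _ _ _ (cube 0 rho)).
- exact: measurable_cube.
- suff : (0 < lebesgue_rV R n (cube 0%R rho))%E by [].
  by rewrite (lebesgue_cube _ (ltW rho0)) lte_fin exprn_gt0// mulr_gt0.
move=> x /lower BK; rewrite (le_trans _ (lee_abs _))// EFinM.
have : (0 <= K^-1%:E)%E by rewrite lee_fin invr_ge0 ltW.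
move=> /(lee_wpmul2l) /(_ _ _ BK) /le_trans; apply.
by rewrite muleA -EFinM mulVf ?gt_eqF// mul1e.
Qed.

End block_lower_bound.

(** * Comparison with powers and conclusion *)

Section growth_against_powers.
Variable R : realType.

Lemma double_exponential_unbounded (K alpha c : R) : 0 < c ->
  exists n : nat, K < c * 2 `^ (alpha * n%:R) * 2 ^+ (2 ^ n).
Proof.
move=> c0; have [L aL] : exists L : nat, `|alpha| <= L%:R.
  by exists (Num.bound `|alpha|); exact/ltW/archi_boundP.
have [P KP] : exists P : nat, K / c < P%:R.
  have [|K0] := leP (K / c) 0; first by exists 1%N; rewrite (le_lt_trans _ ltr01).
  by exists (Num.bound (K / c)); apply: archi_boundP; exact: ltW.
(* for n = 2 m and m >= 2 L + 2, 2 ^ n is at least (L + 1) n: this absorbs the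
   power of exponent alpha n and leaves a surplus factor 2 ^ n *)
pose m := maxn P (2 * L + 2); exists (2 * m)%N.
have nL : ((L + 1) * (2 * m) <= 2 ^ (2 * m))%N.
  rewrite mul2n -addnn expnD; apply: (@leq_trans (m * m)).
    rewrite addnn -mul2n mulnA leq_mul2r; apply/orP; right.
    by rewrite mulnDl mul1n mulnC leq_max leqnn orbT.
  by apply: leq_mul; apply: ltnW; exact: ltn_expl.
have : K / c < 2 ^+ (2 * m).
  apply: lt_le_trans KP _; rewrite -natrX ler_nat.
  apply: (@leq_trans m); first exact: leq_maxl.
  by apply: (leq_trans (ltnW (ltn_expl m (ltnSn 1)))); rewrite leq_exp2l// leq_pmull.
rewrite ltr_pdivrMr// => /lt_le_trans; apply.
rewrite mulrC -mulrA ler_wpM2l ?(ltW c0)//.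
apply: (@le_trans _ _ (2 `^ (alpha * (2 * m)%:R) * 2 ^+ ((L + 1) * (2 * m)))); last first.
  by rewrite ler_wpM2l ?powR_ge0// ler_eXn2l ?ltr1n.
rewrite -!powR_mulrn// -powRD; last by rewrite pnatr_eq0 implybT.
set N := (2 * m)%N; rewrite ler_powR ?ler1n// [in leRHS]natrM natrD mulrDl mul1r addrA.
by rewrite lerDr -mulrDl mulr_ge0// -lerBlDl sub0r (le_trans _ aL)// -normrN ler_norm.
Qed.

End growth_against_powers.

Section neighbourhoods.
Variables (R : realType) (n : nat).

Lemma nbhs_cube (x : 'rV[R]_n) (A : set 'rV[R]_n) : nbhs x A ->
  exists2 r : R, 0 < r & cube x r `<=` A.
Proof.
move=> /nbhs_ballP[e /= e0 xeA]; exists (e / 2); first exact: divr_gt0.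
move=> y yx; apply: xeA; split => // i j; rewrite ord1 -ball_normE /= distrC.
by apply: le_lt_trans (yx j) _; rewrite ltr_pdivrMr// ltr_pMr// ltr1n.
Qed.

Lemma open_neq0 (U : set 'rV[R]_n) : (0 < n)%N -> open U -> U !=set0 ->
  exists2 x, U x & x != 0.
Proof.
move=> n0 oU [z Uz]; have [z0|] := eqVneq z 0; last by exists z.
have [r r0 zrU] := nbhs_cube (open_nbhs_nbhs (conj oU Uz)).
exists (const_mx r).
  by apply: zrU => i; rewrite z0 !mxE subr0 ger0_norm// ltW.
apply/eqP => /rowP /(_ (Ordinal n0)); rewrite !mxE => /eqP.
by rewrite gt_eqF.
Qed.

End neighbourhoods.

Theorem proposition4p14 (R : realType) (d : nat) (hd : (3 <= d)%N)
    (phi : 'rV[R]_d -> R) (hphi : littlewood_paley phi)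
    (u0 u0hat : 'rV[R]_d -> R) (hu0 : is_fourier u0 (fun xi => (u0hat xi)%:E))
    (u0hat_ge0 : forall xi, xi != 0 -> 0 <= u0hat xi)
    (u0hat_away : exists (U : set 'rV[R]_d) (eps : R),
      [/\ open U, U !=set0, 0 < eps &
          forall xi, U xi -> eps <= `|u0hat xi|]) :
  exists a0 : R, 0 < a0 /\
    forall a : R, a0 <= a ->
    forall u1 : 'rV[R]_d -> R,
      solution_at (fun xi => a * u0hat xi) 1 u1 ->
      forall alpha : R, ~ besov phi alpha u1.
Proof.
have d0 : (0 < d)%N by exact: leq_trans hd.
have [U [eps [oU Un0 eps0 Ueps]]] := u0hat_away.
have [x0 Ux0 x0_neq0] := open_neq0 d0 oU Un0.
have [k wink] := window_neq0 hphi x0_neq0.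
have [i x0i] : exists i, x0 0 i != 0.
  apply/existsP; apply: contra_neqT x0_neq0 => /existsPn H.
  by apply/rowP => i; rewrite mxE; apply/eqP; have := H i; rewrite negbK.
(* a cube about x0 inside U, away from the origin, on which some dyadic dilate
   of the window is bounded below by m *)
pose rho : R := `|x0 0 i| / 2.
have win_gt0 : 0 < window phi ((2 : R) ^ k *: x0).
  by rewrite lt_def wink; have /andP[] := window_itv hphi ((2 : R) ^ k *: x0).
have rho0 : 0 < rho by rewrite divr_gt0// normr_gt0.
have [m m0 mwin] : exists2 m : R, 0 < m & m < window phi ((2 : R) ^ k *: x0).
  exists (window phi ((2 : R) ^ k *: x0) / 2); first exact: divr_gt0.
  by rewrite ltr_pdivrMr// ltr_pMr ?ltr1n.
have [r r0 x0r] : exists2 r : R, 0 < r & cube x0 r `<=`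
    [set xi | [/\ U xi, rho < `|xi 0 i| & m < window phi ((2 : R) ^ k *: xi)]].
  apply: nbhs_cube.
  have nU : nbhs x0 U by exact: open_nbhs_nbhs.
  have ni : nbhs x0 [set xi : 'rV[R]_d | rho < `|xi 0 i|].
    apply: (@cvgr_gt _ _ (nbhs (x0 : 'rV[R]_d)) _ (fun xi : 'rV[R]_d => `|xi 0 i|) `|x0 0 i|).
      by apply: cvg_norm; exact: coord_continuous.
    by rewrite /rho ltr_pdivrMr// ltr_pMr ?ltr1n// normr_gt0.
  have nw : nbhs x0 [set xi : 'rV[R]_d | m < window phi ((2 : R) ^ k *: xi)].
    apply: (@cvgr_gt _ _ (nbhs (x0 : 'rV[R]_d)) _
      (fun xi : 'rV[R]_d => window phi ((2 : R) ^ k *: xi))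
      (window phi ((2 : R) ^ k *: x0))).
      apply: (@cvg_comp _ _ _ ( *:%R ((2 : R) ^ k)) (window phi)); last exact: window_continuous.
      exact: scaler_continuous.
    exact: mwin.
  by apply: filterS3 nU ni nw => xi.
pose M : R := \sum_(i < d) (`|x0 0 i| + r).
have x0M xi : cube x0 r xi -> rho <= enorm xi <= M.
  move=> xir; have [_ xii _] := x0r _ xir.
  rewrite (le_trans (ltW xii)) ?le_coord_enorm//=.
  apply: le_trans (enorm_le_sum xi) _; apply: ler_sum => l _.
  by rewrite -lerBlDl (le_trans _ (xir l))// lerB_dist.
exists (gain d r rho M 0 * expR (M ^+ 2) / eps).
have gain_gt0 l : 0 < gain d r rho M l.
  by rewrite mulr_gt0 ?exprn_gt0// divr_gt0 ?exprn_gt0// gain_rate_gt0.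
split; first by rewrite divr_gt0// mulr_gt0// expR_gt0.
move=> a a0a u1 solu1 alpha [_ besov_fin].
have a_gt0 : 0 < a by rewrite (lt_le_trans _ a0a)// divr_gt0// mulr_gt0// expR_gt0.
pose v0 xi := a * u0hat xi.
have v0_ge0 xi : xi != 0 -> 0 <= v0 xi by move=> /u0hat_ge0; exact/mulr_ge0/ltW.
have v0_large xi : cube x0 r xi -> gain d r rho M 0 * expR (M ^+ 2) <= v0 xi.
  move=> xir; have [Uxi xii _] := x0r _ xir.
  have xi0 : xi != 0.
    by apply: contraTneq xii => ->; rewrite mxE normr0 -leNgt ltW.
  apply: (@le_trans _ _ (a * eps)); first by rewrite -ler_pdivrMr.
  rewrite /v0 ler_pM2l//.
  by have := Ueps _ Uxi; rewrite ger0_norm// u0hat_ge0.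
(* the block of index n - k dilates the cube about 2 ^ n x0 back to the place
   where the window is at least m *)
pose K := (2 * pi) ^+ d * fourier_cst R d ^+ 2.
have K0 : 0 < K.
  by rewrite mulr_gt0// exprn_gt0 ?fourier_cst_gt0// mulr_gt0// pi_gt0.
pose c := 2 `^ (- (alpha * k%:~R)) * (2 / gain_rate d r rho M * (m / 2) * (2 * r) ^+ d).
have c0 : 0 < c.
  rewrite mulr_gt0 ?powR_gt0// mulr_gt0 ?exprn_gt0 ?mulr_gt0 ?divr_gt0//.
  by rewrite invr_gt0 gain_rate_gt0.
have block n : (((c * 2 `^ (alpha * n%:R) * 2 ^+ (2 ^ n))%:E <=
    K%:E * besov_norm phi alpha u1))%E.
  have scaled xi : cube (2 ^+ n *: x0) r xi ->
      m <= window phi ((2 : R) ^ (- (n%:Z - k)) *: xi).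
    move=> /(scale_cube (ltW r0)) /x0r[_ _ /ltW].
    rewrite scalerA opprB expfzDr ?pnatr_eq0//.
    by rewrite -[in X in _ -> _ <= window _ ((_ * X) *: _)]invr_expz -exprnP.
  have lower := @block_lower_bound R d d0 phi hphi u1 _ (n%:Z - k) (2 ^+ n *: x0)
    (gain d r rho M n) m r solu1 (fun xi => solution_ge0 d0 v0_ge0 1)
    (ltW (gain_gt0 n)) (ltW m0) (ltW r0)
    (solution_growth d0 v0_ge0 r0 rho0 x0M v0_large (n := n)) scaled.
  have upper : ((2 `^ (alpha * (n%:Z - k)%:~R))%:E *
      Lnorm (lebesgue_rV R d) +oo (Defs.conv (dilate phi (n%:Z - k)) u1) <=
      besov_norm phi alpha u1)%E.
    by apply: ereal_sup_ubound; exists (n%:Z - k).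
  have p0 : (0 <= (2 `^ (alpha * (n%:Z - k)%:~R))%:E)%E by rewrite lee_fin powR_ge0.
  have Ke0 : (0 <= K%:E)%E by rewrite lee_fin ltW.
  apply: le_trans (lee_wpmul2l Ke0 upper); rewrite muleCA.
  apply: le_trans (lee_wpmul2l p0 lower); rewrite -EFinM lee_fin /c.
  rewrite rmorphB/= mulrBr powRD ?pnatr_eq0 ?implybT// -pmulrn.
  rewrite /gain; set X := 2 `^ (alpha * n%:R); set Y := 2 `^ (- _).
  set q := 2 ^+ (2 ^ n); set V := (2 * r) ^+ d; set kap := gain_rate _ _ _ _.
  pose W := X * Y * q / kap * (m / 2) * V.
  have W0 : 0 <= W.
    have kap0 : 0 < kap by exact: gain_rate_gt0.
    by rewrite /W /V !mulr_ge0 ?powR_ge0 ?exprn_ge0 ?mulr_ge0 ?invr_ge0 ?(ltW m0)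
      ?(ltW kap0) ?(ltW r0).
  have -> : Y * (2 / kap * (m / 2) * V) * X * q = W * 2 by rewrite /W; ring.
  have -> : X * Y * (2 ^+ n.+1 / kap * q * (m / 2) * V) = W * 2 ^+ n.+1.
    by rewrite /W; ring.
  by rewrite ler_wpM2l// exprS ler_peMr// exprn_ege1// ler1n.
have bfin : (0 <= besov_norm phi alpha u1)%E.
  apply: le_trans (ereal_sup_ubound _); last by exists 0.
  by apply: mule_ge0; [rewrite lee_fin powR_ge0|exact: Lnorm_ge0].
have [n] := double_exponential_unbounded (K * fine (besov_norm phi alpha u1)) alpha c0.
have fin : besov_norm phi alpha u1 \is a fin_num by rewrite ge0_fin_numE.
by have := block n; rewrite -[X in (_ * X)%E](fineK fin) -EFinM lee_fin leNgt => /negP.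
Qed.
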